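(* Let $R$ be a commutative Noetherian ring with non-zero identity, $\mathfrak a$ an ideal of $R$, $M$ and $X$ finitely generated $R$-modules and $n$ a non-negative integer. Then the following statements are equivalent: (i) $\dim_R(H^i_{\mathfrak a}(M,X))\le 0$ for all $i\le n$. (ii) $H^i_{\mathfrak a}(M,X)$ is Artinian for all $i\le n$. (iii) $H^i_{\mathfrak a}(M,X)$ is Artinian and $(\mathfrak a+\operatorname{Ann}_RM)$-cofinite for all $i\le n$. The same equivalences hold with ''for all $i\le n$'' replaced by ''for all $i$'' in each of (i), (ii), (iii). In particular, if $\dim_R(R/\mathfrak a)=0$, then $H^i_{\mathfrak a}(M,X)$ is Artinian and $(\mathfrak a+\operatorname{Ann}_RM)$-cofinite for all $i$.
   Context: $H^i_{\mathfrak a}(M,X)=\varinjlim_{k}\operatorname{Ext}^i_R(M/\mathfrak a^kM,X)$ is the $i$-th generalized local cohomology module. $\dim_R(Y)$ is the Krull dimension of (the support of) the $R$-module $Y$; the zero module satisfies $\dim_R\le 0$. For an ideal $\mathfrak b$, an $R$-module $Y$ is $\mathfrak b$-cofinite if $\operatorname{Supp}_R(Y)\subseteq V(\mathfrak b)$ and $\operatorname{Ext}^i_R(R/\mathfrak b,Y)$ is finitely generated for all $i$. *)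

(* Defs.v *)
From HB Require Import structures.
From mathcomp Require Import all_boot all_algebra.
From mathcomp Require Import boolp classical_sets functions cardinality fsbigop.

Set Implicit Arguments.
Unset Strict Implicit.
Unset Printing Implicit Defensive.

Import GRing.Theory.
Local Open Scope ring_scope.
Local Open Scope quotient_scope.

Section Submodule.
Variables (R : comNzRingType) (M : lmodType R) (N : submodClosed M).

Record submod := Submod { submod_val :> M; _ : submod_val \in N }.
HB.instance Definition _ := [isSub for submod_val].
HB.instance Definition _ := [Choice of submod by <:].
HB.instance Definition _ := [SubChoice_isSubLmodule of submod by <:].

Definition addpred : {pred M} := fun x => x \in N.
Fact addpred_closed : zmod_closed addpred.
Proof. by have /GRing.submod_closedB := submodClosedP N. Qed.
HB.instance Definition _ := GRing.isZmodClosed.Build M addpred addpred_closed.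

Definition quotmod := Quotient.quot (addpred : zmodClosed M).
HB.instance Definition _ := GRing.Zmodule.on quotmod.

Definition quot_pi (x : M) : quotmod :=
  \pi_(Quotient.quot (addpred : zmodClosed M)) x.
Definition quot_repr (q : quotmod) : M :=
  repr (q : Quotient.quot (addpred : zmodClosed M)).

Lemma quot_reprK : cancel quot_repr quot_pi.
Proof. exact: reprK. Qed.

Lemma quot_piE (x y : M) : (quot_pi x == quot_pi y) = (x - y \in N).
Proof. exact/esym/(@Quotient.idealrBE _ (addpred : zmodClosed M)). Qed.

Lemma quot_piD : {morph quot_pi : x y / x + y}.
Proof. exact: Quotient.pi_add. Qed.

Definition quot_scale (c : R) (q : quotmod) : quotmod :=
  quot_pi (c *: quot_repr q).

Lemma quot_piZ (c : R) (x : M) : quot_pi (c *: x) = quot_scale c (quot_pi x).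
Proof.
by apply/eqP; rewrite quot_piE -scalerBr rpredZ // -quot_piE quot_reprK.
Qed.

Fact quot_scalerA c d q : quot_scale c (quot_scale d q) = quot_scale (c * d) q.
Proof. by rewrite -[q]quot_reprK -!quot_piZ scalerA. Qed.

Fact quot_scale1r : left_id 1 quot_scale.
Proof. by move=> q; rewrite -[q]quot_reprK -!quot_piZ scale1r. Qed.

Fact quot_scalerDr : right_distributive quot_scale +%R.
Proof.
move=> c p q; rewrite -[p]quot_reprK -[q]quot_reprK -quot_piD -!quot_piZ.
by rewrite scalerDr quot_piD.
Qed.

Fact quot_scalerDl q : {morph quot_scale^~ q : c d / c + d}.
Proof.
by move=> c d; rewrite -[q]quot_reprK -!quot_piZ scalerDl quot_piD.
Qed.

HB.instance Definition _ := GRing.Zmodule_isLmodule.Build R quotmod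
  quot_scalerA quot_scale1r quot_scalerDr quot_scalerDl.

Fact quot_pi_is_linear : linear quot_pi.
Proof. by move=> c x y; rewrite quot_piD quot_piZ. Qed.
HB.instance Definition _ :=
  GRing.isLinear.Build R M quotmod _ quot_pi quot_pi_is_linear.

End Submodule.

Section InducedMaps.
Variables (R : comNzRingType) (M M' : lmodType R).
Variables (N : submodClosed M) (N' : submodClosed M').
Variable f : {linear M -> M'}.
Variable fN : forall x, x \in N -> f x \in N'.

Definition submod_map (x : submod N) : submod N' := Submod (fN (valP x)).

Fact submod_map_is_linear : linear submod_map.
Proof. by move=> c x y; apply: val_inj; rewrite /= linearP. Qed.
HB.instance Definition _ := GRing.isLinear.Build R (submod N) (submod N') _
  submod_map submod_map_is_linear.

Definition quot_map & (forall x, x \in N -> f x \in N') :=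
  fun q : quotmod N => quot_pi N' (f (quot_repr q)).

Lemma quot_mapE x : quot_map fN (quot_pi N x) = quot_pi N' (f x).
Proof.
by apply/eqP; rewrite quot_piE -linearB fN // -quot_piE quot_reprK.
Qed.

Fact quot_map_is_linear : linear (quot_map fN).
Proof.
move=> c p q; rewrite -[p]quot_reprK -[q]quot_reprK -linearP !quot_mapE.
by rewrite !linearP.
Qed.
HB.instance Definition _ := GRing.isLinear.Build R (quotmod N) (quotmod N') _
  (quot_map fN) quot_map_is_linear.

End InducedMaps.

Section KernelImage.
Variables (R : comNzRingType) (M M' : lmodType R) (f : {linear M -> M'}).

Definition ker_pred : {pred M} := fun x => f x == 0.
Fact ker_pred_closed : submod_closed ker_pred.
Proof.
split=> [|c x y]; first by rewrite unfold_in /ker_pred linear0.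
rewrite !unfold_in /ker_pred linearP => /eqP-> /eqP->.
by rewrite scaler0 addr0.
Qed.
HB.instance Definition _ :=
  GRing.isSubmodClosed.Build R M ker_pred
    (GRing.submod_closed_semi ker_pred_closed).
Definition kernel : submodClosed M := ker_pred.

Definition im_pred : {pred M'} := fun y => `[< exists x, y = f x >].
Fact im_pred_closed : submod_closed im_pred.
Proof.
split=> [|c x y]; first by apply/asboolP; exists 0; rewrite linear0.
move=> /asboolP[u ->] /asboolP[v ->]; apply/asboolP; exists (c *: u + v).
by rewrite linearP.
Qed.
HB.instance Definition _ :=
  GRing.isSubmodClosed.Build R M' im_pred
    (GRing.submod_closed_semi im_pred_closed).
Definition image_of : submodClosed M' := im_pred.

End KernelImage.

Section TrivialSubmodules.
Variables (R : comNzRingType) (M : lmodType R).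

Definition zero_pred : {pred M} := fun x => x == 0.
Fact zero_pred_closed : submod_closed zero_pred.
Proof.
split=> [|c x y]; rewrite !unfold_in /zero_pred ?eqxx //.
by move=> /eqP-> /eqP->; rewrite scaler0 addr0.
Qed.
HB.instance Definition _ :=
  GRing.isSubmodClosed.Build R M zero_pred
    (GRing.submod_closed_semi zero_pred_closed).
Definition zero_submod : submodClosed M := zero_pred.

Definition full_pred : {pred M} := fun=> true.
Fact full_pred_closed : submod_closed full_pred.
Proof. by []. Qed.
HB.instance Definition _ :=
  GRing.isSubmodClosed.Build R M full_pred
    (GRing.submod_closed_semi full_pred_closed).
Definition full_submod : submodClosed M := full_pred.

End TrivialSubmodules.

Section SubIn.
Variables (R : comNzRingType) (M : lmodType R) (N L : submodClosed M).

Definition sub_in_pred : {pred submod N} := fun x => val x \in L.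
Fact sub_in_pred_closed : submod_closed sub_in_pred.
Proof.
split=> [|c x y]; first exact: rpred0.
by move=> Lx Ly; exact: (@rpredD _ L _ _ (@rpredZ _ _ L c _ Lx) Ly).
Qed.
HB.instance Definition _ := GRing.isSubmodClosed.Build R (submod N) sub_in_pred
    (GRing.submod_closed_semi sub_in_pred_closed).
Definition sub_in : submodClosed (submod N) := sub_in_pred.

End SubIn.

Section Hom.
Variables (R : comNzRingType) (M X : lmodType R).

Definition linear_pred : {pred M -> X} := fun f => `[< linear f >].
Fact linear_pred_closed : submod_closed linear_pred.
Proof.
split=> [|c f g]; first by apply/asboolP => a x y; rewrite /= scaler0 addr0.
move=> /asboolP lf /asboolP lg; apply/asboolP => a x y.
rewrite !fctE /= lf lg !scalerDr !scalerA [c * a]mulrC -!addrA.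
by congr (_ + _); rewrite addrCA.
Qed.
HB.instance Definition _ :=
  GRing.isSubmodClosed.Build R (M -> X) linear_pred
    (GRing.submod_closed_semi linear_pred_closed).

Definition Hom : lmodType R := submod (linear_pred : submodClosed (M -> X)).

End Hom.

Section Precomposition.
Variables (R : comNzRingType) (M M' X : lmodType R) (g : {linear M' -> M}).

Fact precomp_linear (f : Hom M X) :
  (val f \o g) \in (@linear_pred R M' X).
Proof.
apply/asboolP => c x y /=; rewrite linearP.
by have /asboolP -> := valP f.
Qed.

Definition precomp (f : Hom M X) : Hom M' X := Submod (precomp_linear f).

Fact precomp_is_linear : linear precomp.
Proof. by move=> c f h; apply: val_inj. Qed.
HB.instance Definition _ := GRing.isLinear.Build R (Hom M X) (Hom M' X) _
  precomp precomp_is_linear.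

End Precomposition.

Section DirectSum.
Variables (R : comNzRingType) (I : choiceType) (E : I -> lmodType R).

Definition dprod := forall i, E i.
HB.instance Definition _ := Choice.on dprod.

Implicit Types x y : dprod.
Fact dprod_addA : associative (fun x y : dprod => (fun i => x i + y i) : dprod).
Proof.
by move=> x y z; apply: functional_extensionality_dep => i; rewrite addrA.
Qed.
Fact dprod_addC : commutative (fun x y : dprod => (fun i => x i + y i) : dprod).
Proof.
by move=> x y; apply: functional_extensionality_dep => i;
rewrite addrC.
Qed.
Fact dprod_add0 :
  left_id ((fun=> 0) : dprod) (fun x y : dprod => (fun i => x i + y i) : dprod).
Proof.
by move=> x; apply: functional_extensionality_dep => i;
rewrite add0r.
Qed.
Fact dprod_addN : left_inverse ((fun=> 0) : dprod)
  (fun x : dprod => (fun i => - x i) : dprod)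
  (fun x y : dprod => (fun i => x i + y i) : dprod).
Proof.
by move=> x; apply: functional_extensionality_dep => i;
rewrite addNr.
Qed.
HB.instance Definition _ := GRing.isZmodule.Build dprod
  dprod_addA dprod_addC dprod_add0 dprod_addN.

Definition dprod_scale (c : R) (x : dprod) : dprod := fun i => c *: x i.
Fact dprod_scaleA c d x :
  dprod_scale c (dprod_scale d x) = dprod_scale (c * d) x.
Proof.
by apply: functional_extensionality_dep => i;
rewrite /dprod_scale scalerA.
Qed.
Fact dprod_scale1 : left_id 1 dprod_scale.
Proof.
by move=> x; apply: functional_extensionality_dep => i;
rewrite /dprod_scale scale1r.
Qed.
Fact dprod_scaleDr : right_distributive dprod_scale +%R.
Proof.
by move=> c x y; apply: functional_extensionality_dep => i;
rewrite /dprod_scale scalerDr.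
Qed.
Fact dprod_scaleDl x : {morph dprod_scale^~ x : c d / c + d}.
Proof.
by move=> c d; apply: functional_extensionality_dep => i;
rewrite /dprod_scale scalerDl.
Qed.
HB.instance Definition _ := GRing.Zmodule_isLmodule.Build R dprod
  dprod_scaleA dprod_scale1 dprod_scaleDr dprod_scaleDl.

Definition finsupp_pred : {pred dprod} :=
  fun x => `[< finite_set [set i | x i != 0] >].
Fact finsupp_pred_closed : submod_closed finsupp_pred.
Proof.
split=> [|c x y].
  apply/asboolP; rewrite [X in finite_set X](_ : _ = set0)%classic //.
  by apply/seteqP; split=> i //=; rewrite eqxx.
move=> /asboolP fx /asboolP fy; apply/asboolP.
have fxy : finite_set ([set i | x i != 0] `|` [set i | y i != 0])%classic.
  by rewrite finite_setU.
apply: sub_finite_set fxy => i /=.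
have [xi0|] := eqVneq (x i) 0; last by left.
have [yi0|] := eqVneq (y i) 0; last by right.
rewrite -[(c *: x + y) i]/(c *: x i + y i).
by rewrite xi0 yi0 scaler0 addr0 eqxx.
Qed.
HB.instance Definition _ := GRing.isSubmodClosed.Build R dprod finsupp_pred
    (GRing.submod_closed_semi finsupp_pred_closed).

Definition dsum : lmodType R := submod (finsupp_pred : submodClosed dprod).

End DirectSum.

Section FreeModule.
Variable R : comNzRingType.

Definition free (S : choiceType) : lmodType R := dsum (fun _ : S => R^o).

Definition coef (S : choiceType) (x : free S) (s : S) : R := val x s.

Lemma coef_finite (S : choiceType) (x : free S) :
  finite_set [set s | coef x s != 0].
Proof. by have /asboolP := valP x. Qed.

Fact basis_finsupp (S : choiceType) (s : S) :
  ((fun t => (t == s)%:R) : dprod (fun _ : S => R^o)) \in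
    @finsupp_pred R S (fun=> R^o).
Proof.
apply/asboolP; apply: (@sub_finite_set _ _ [set s]%classic) => // t /=.
by have [->|] := eqVneq t s; rewrite //= eqxx.
Qed.
Definition basis (S : choiceType) (s : S) : free S := Submod (basis_finsupp s).

Section Lift.
Variables (S : choiceType) (N : lmodType R) (g : S -> N).

Definition free_lift (x : free S) : N :=
  \sum_(s \in [set: S]) coef x s *: g s.

Lemma free_liftE (A : set S) (x : free S) : finite_set A ->
  (forall s, coef x s != 0 -> A s) ->
  free_lift x = \sum_(s \in A) coef x s *: g s.
Proof.
move=> fA xA; rewrite /free_lift; apply/esym/fsbig_widen => // s [_ /= nAs].
by have [->|/xA//] := eqVneq (coef x s) 0; rewrite scale0r.
Qed.

Fact free_lift_is_linear : linear free_lift.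
Proof.
move=> c x y.
set A := ([set s | coef x s != 0] `|` [set s | coef y s != 0])%classic.
have fA : finite_set A by rewrite finite_setU; split; exact: coef_finite.
have cE s : coef (c *: x + y) s = c * coef x s + coef y s by [].
have xA s : coef x s != 0 -> A s by left.
have yA s : coef y s != 0 -> A s by right.
have cxyA s : coef (c *: x + y) s != 0 -> A s.
  rewrite cE; have [->|/xA//] := eqVneq (coef x s) 0.
  by rewrite mulr0 add0r => /yA.
rewrite (free_liftE fA xA) (free_liftE fA yA) (free_liftE fA cxyA).
rewrite !fsbig_finite // scaler_sumr -big_split /=.
by apply: eq_bigr => s _; rewrite cE scalerDl scalerA.
Qed.
HB.instance Definition _ :=
  GRing.isLinear.Build R (free S) N _ free_lift free_lift_is_linear.

Lemma free_lift_basis (s : S) : free_lift (basis s) = g s.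
Proof.
rewrite (@free_liftE [set s]%classic) //; last first.
  by move=> t; rewrite /coef /=; have [->|] := eqVneq t s; rewrite ?eqxx.
by rewrite fsbig_set1 /coef /= eqxx scale1r.
Qed.

End Lift.

Lemma free_lift_comp (S : choiceType) (N N' : lmodType R) (g : S -> N)
    (h : {linear N -> N'}) x :
  h (free_lift g x) = free_lift (h \o g) x.
Proof.
rewrite !(@free_liftE _ _ _ _ x (coef_finite x)) //.
rewrite !fsbig_finite ?linear_sum //; try exact: coef_finite.
by apply: eq_bigr => s _; rewrite linearZ.
Qed.

End FreeModule.

Section Resolution.
Variable R : comNzRingType.

(* The standard free resolution of [M]: [res M 0] is the free module on the
   underlying set of [M], and [res M n.+1] is the free module on the underlying
   set of the kernel of the preceding map. *)

Definition aug (M : lmodType R) : {linear free R M -> M} := free_lift id.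

Lemma aug_surj (M : lmodType R) (x : M) : exists y, aug M y = x.
Proof. by exists (basis R x); exact: free_lift_basis. Qed.

Definition syz (M : lmodType R) : lmodType R := submod (kernel (aug M)).

Fixpoint syzygy (M : lmodType R) (n : nat) : lmodType R :=
  if n is n'.+1 then syz (syzygy M n') else M.

Definition res (M : lmodType R) (n : nat) : lmodType R := free R (syzygy M n).

Definition res_d (M : lmodType R) (n : nat) (x : res M n.+1) : res M n :=
  val (aug (syzygy M n.+1) x).

Fact res_d_is_linear M n : linear (@res_d M n).
Proof. by move=> c x y; rewrite /res_d !linearP. Qed.
HB.instance Definition _ M n :=
  GRing.isLinear.Build R (res M n.+1) (res M n) _ (@res_d M n)
    (@res_d_is_linear M n).

Lemma res_exact0 M (x : res M 0) : aug M x = 0 <-> exists y, x = res_d y.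
Proof.
split=> [x0|[y ->]]; last exact/eqP/(valP (aug (syzygy M 1) y)).
have kx : x \in kernel (aug M) by exact/eqP.
have [y yx] := @aug_surj (syzygy M 1) (Submod kx).
by exists y; rewrite /res_d yx.
Qed.

Lemma res_exact M n (x : res M n.+1) : res_d x = 0 <-> exists y, x = res_d y.
Proof.
split=> [x0|[y ->]].
  have kx : x \in kernel (aug (syzygy M n.+1)) by exact/eqP/val_inj.
  have [y yx] := @aug_surj (syzygy M n.+2) (Submod kx).
  by exists y; rewrite /res_d yx.
rewrite {1}/res_d.
by have /eqP -> := valP (aug (syzygy M n.+2) y).
Qed.

Definition free_map (M M' : lmodType R) (f : {linear M -> M'}) :
  {linear free R M -> free R M'} := free_lift (fun x => basis R (f x)).

Lemma aug_natural (M M' : lmodType R) (f : {linear M -> M'}) x :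
  aug M' (free_map f x) = f (aug M x).
Proof.
rewrite /aug /= !free_lift_comp; congr free_lift.
by apply/funext => y /=; rewrite free_lift_basis.
Qed.

Fact free_map_kernel (M M' : lmodType R) (f : {linear M -> M'}) x :
  x \in kernel (aug M) -> free_map f x \in kernel (aug M').
Proof. by move/eqP=> x0; apply/eqP; rewrite aug_natural x0 linear0. Qed.

Definition syz_map (M M' : lmodType R) (f : {linear M -> M'}) :
  {linear syz M -> syz M'} := submod_map (@free_map_kernel M M' f).

Fixpoint syzygy_map (M M' : lmodType R) (f : {linear M -> M'}) (n : nat) :
    {linear syzygy M n -> syzygy M' n} :=
  if n is n'.+1 then syz_map (syzygy_map f n') else f.

Definition res_map (M M' : lmodType R) (f : {linear M -> M'}) (n : nat) :
  {linear res M n -> res M' n} := free_map (syzygy_map f n).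

Lemma res_map_d (M M' : lmodType R) (f : {linear M -> M'}) n x :
  res_map f n (res_d x) = res_d (res_map f n.+1 x).
Proof. by rewrite /res_d /res_map aug_natural. Qed.

End Resolution.

Section Ext.
Variables (R : comNzRingType) (M X : lmodType R).

Definition cochain (n : nat) : lmodType R := Hom (res M n) X.

Definition cochain_d (n : nat) : {linear cochain n -> cochain n.+1} :=
  @precomp R _ _ X (@res_d R M n).

Definition cocycles (n : nat) : submodClosed (cochain n) :=
  kernel (cochain_d n).

Definition coboundaries (n : nat) : submodClosed (cochain n) :=
  if n is n'.+1 then image_of (cochain_d n') else zero_submod _.

End Ext.

Definition Ext (R : comNzRingType) (n : nat) (M X : lmodType R) : lmodType R :=
  quotmod (sub_in (cocycles M X n) (coboundaries M X n)).

Section ExtMap.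
Variables (R : comNzRingType) (M M' X : lmodType R) (f : {linear M -> M'}).

Definition cochain_map (n : nat) : {linear cochain M' X n -> cochain M X n} :=
  @precomp R _ _ X (res_map f n).

Lemma cochain_map_d n x :
  cochain_map n.+1 (cochain_d M' X n x) = cochain_d M X n (cochain_map n x).
Proof.
apply: val_inj; apply/funext => y /=.
by rewrite (res_map_d f y).
Qed.

Fact cochain_map_cocycles n x :
  x \in cocycles M' X n -> cochain_map n x \in cocycles M X n.
Proof. by move/eqP=> x0; apply/eqP; rewrite -cochain_map_d x0 linear0. Qed.

Definition cocycle_map (n : nat) :
    {linear submod (cocycles M' X n) -> submod (cocycles M X n)} :=
  submod_map (@cochain_map_cocycles n).

Fact cocycle_map_coboundaries n x :
  x \in sub_in (cocycles M' X n) (coboundaries M' X n) ->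
  cocycle_map n x \in sub_in (cocycles M X n) (coboundaries M X n).
Proof.
rewrite -!topredE /= /sub_in_pred /=.
case: n x => [|n] x /=; first by move/eqP=> x0; apply/eqP; rewrite x0 linear0.
move=> /asboolP[y yx]; apply/asboolP; exists (cochain_map n y).
by rewrite -cochain_map_d -yx.
Qed.

Definition Ext_map (n : nat) : {linear Ext n M' X -> Ext n M X} :=
  quot_map (@cocycle_map_coboundaries n).

End ExtMap.

Section DirectLimit.
Variables (R : comNzRingType) (E : nat -> lmodType R).
Variable phi : forall k, {linear E k -> E k.+1}.

Fact shift_finsupp (x : dsum E) :
  ((fun k => if k is k'.+1 then phi k' (val x k') else 0) : dprod E) \in
    @finsupp_pred R nat E.
Proof.
have /asboolP fx := valP x; apply/asboolP.
apply: sub_finite_set (finite_image S fx) => -[|k] /=; first by rewrite eqxx.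
move=> nz; exists k => //.
by apply: contra_neq nz => ->; rewrite linear0.
Qed.

Definition shift (x : dsum E) : dsum E := Submod (shift_finsupp x).

Definition id_sub_shift (x : dsum E) : dsum E := x - shift x.

Fact id_sub_shift_is_linear : linear id_sub_shift.
Proof.
move=> c x y; rewrite /id_sub_shift scalerBr addrACA -opprD.
congr (_ - _); apply: val_inj; apply: functional_extensionality_dep => -[|k] /=.
  by rewrite [RHS](_ : _ = c *: 0 + 0) // scaler0 addr0.
by rewrite -[RHS]/(c *: phi k (val x k) + phi k (val y k)) -linearP.
Qed.
HB.instance Definition _ := GRing.isLinear.Build R (dsum E) (dsum E) _
  id_sub_shift id_sub_shift_is_linear.

(* The quotient of the direct sum of the [E k] by the submodule generated by the
   elements [x - phi k x], where [x : E k] and [phi k x : E k.+1] are seen in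
   the direct sum. *)
Definition dirlim : lmodType R := quotmod (image_of id_sub_shift).

End DirectLimit.

Notation ideal R := (submodClosed R^o).

Section Ideals.
Variable R : comNzRingType.

Definition smul_pred (M : lmodType R) (a : ideal R) (N : submodClosed M) :
    {pred M} :=
  fun x => `[< exists2 s : seq (R * M),
    (forall p, p \in s -> p.1 \in a /\ p.2 \in N) &
    x = \sum_(p <- s) p.1 *: p.2 >].
Fact smul_pred_closed (M : lmodType R) (a : ideal R) (N : submodClosed M) :
  submod_closed (smul_pred a N).
Proof.
split=> [|c x y]; first by apply/asboolP; exists [::]; rewrite ?big_nil.
move=> /asboolP[s sP ->] /asboolP[t tP ->]; apply/asboolP.
exists ([seq (c * p.1, p.2) | p <- s] ++ t).
  move=> p; rewrite mem_cat => /orP[/mapP[q /sP[qa qN] ->]|/tP//].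
  by split=> //; apply: (@rpredZ _ _ a c _ qa).
rewrite big_cat big_map scaler_sumr; congr (_ + _).
by apply: eq_bigr => p _; rewrite scalerA.
Qed.
HB.instance Definition _ (M : lmodType R) (a : ideal R) (N : submodClosed M) :=
  GRing.isSubmodClosed.Build R M (smul_pred a N)
    (GRing.submod_closed_semi (smul_pred_closed a N)).

Definition smul (M : lmodType R) (a : ideal R) (N : submodClosed M) :
  submodClosed M := smul_pred a N.

Fixpoint ideal_pow (a : ideal R) (k : nat) : ideal R :=
  if k is k'.+1 then smul a (ideal_pow a k') else full_submod R^o.

Lemma ideal_powS_sub (a : ideal R) k r :
  r \in ideal_pow a k.+1 -> r \in ideal_pow a k.
Proof.
move=> /asboolP[s sP ->]; rewrite big_seq.
by apply: rpred_sum => p /sP[_ pa]; exact: rpredZ.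
Qed.

Definition ideal_add_pred (a b : ideal R) : {pred R^o} :=
  fun r => `[< exists u v, [/\ u \in a, v \in b & r = u + v] >].
Fact ideal_add_pred_closed a b : submod_closed (ideal_add_pred a b).
Proof.
split=> [|c x y].
  by apply/asboolP; exists 0, 0; rewrite !rpred0 addr0.
move=> /asboolP[u [v [ua vb ->]]] /asboolP[u' [v' [u'a v'b ->]]].
apply/asboolP; exists (c *: u + u'), (c *: v + v').
by rewrite !rpredD ?rpredZ // scalerDr addrACA.
Qed.
HB.instance Definition _ a b :=
  GRing.isSubmodClosed.Build R R^o (ideal_add_pred a b)
    (GRing.submod_closed_semi (ideal_add_pred_closed a b)).
Definition ideal_add (a b : ideal R) : ideal R := ideal_add_pred a b.

Definition ann_pred (M : lmodType R) : {pred R^o} :=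
  fun r => `[< forall x : M, (r : R) *: x = 0 >].
Fact ann_pred_closed M : submod_closed (ann_pred M).
Proof.
split=> [|c r s]; first by apply/asboolP => x; rewrite scale0r.
move=> /asboolP r0 /asboolP s0; apply/asboolP => x.
by rewrite scalerDl s0 addr0 -scalerA r0 scaler0.
Qed.
HB.instance Definition _ M :=
  GRing.isSubmodClosed.Build R R^o (ann_pred M)
    (GRing.submod_closed_semi (ann_pred_closed M)).
Definition ann (M : lmodType R) : ideal R := ann_pred M.

End Ideals.

Section Conditions.
Variable R : comNzRingType.

Definition fin_gen (M : lmodType R) : Prop :=
  exists n (g : 'I_n -> M), forall x,
  exists c : 'I_n -> R, x = \sum_(i < n) c i *: g i.

Definition noetherian_ring : Prop := forall a : ideal R, fin_gen (submod a).

Definition artinian (M : lmodType R) : Prop :=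
  forall N : nat -> submodClosed M,
  (forall k x, x \in N k.+1 -> x \in N k) ->
  exists k0, forall k, (k0 <= k)%N -> N k =i N k0.

(* Equality of the fractions [u.1 / u.2] and [v.1 / v.2] in the localization of
   [M] at [p], for [u.2] and [v.2] outside [p]. *)
Definition eq_frac (M : lmodType R) (p : prime_idealr R) (u v : M * R) : Prop :=
  exists2 t : R, t \notin p & t *: (v.2 *: u.1 - u.2 *: v.1) = 0.

Definition supp (M : lmodType R) (p : prime_idealr R) : Prop :=
  exists (x : M) (s : R), s \notin p /\ ~ eq_frac p (x, s) (0, 1).

Definition prime_chain (n : nat) (p : nat -> prime_idealr R) : Prop :=
  forall i, (i < n)%N ->
    {subset p i <= p i.+1} /\ ~ {subset p i.+1 <= p i}.

Definition supp_chain (M : lmodType R) (n : nat) : Prop :=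
  exists p : nat -> prime_idealr R,
    prime_chain n p /\ forall i, (i <= n)%N -> supp M (p i).

(* [dim_le M d] bounds the lengths of the chains of primes in the support of [M]
   by [d]; it holds for the zero module, whose support is empty, while [dim_eq]
   does not: the dimension of the zero module is negative. *)
Definition dim_le (M : lmodType R) (d : nat) : Prop :=
  forall n, supp_chain M n -> (n <= d)%N.

Definition dim_eq (M : lmodType R) (d : nat) : Prop :=
  dim_le M d /\ supp_chain M d.

Definition cofinite (b : ideal R) (M : lmodType R) : Prop :=
  (forall p, supp M p -> forall r, r \in b -> r \in p) /\
  (forall i, fin_gen (Ext i (quotmod b) M)).

End Conditions.

Section GeneralizedLocalCohomology.
Variables (R : comNzRingType) (a : ideal R) (M : lmodType R).

Definition pow_submod (k : nat) : submodClosed M :=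
  smul (ideal_pow a k) (full_submod M).

Fact pow_submodS (k : nat) x : x \in pow_submod k.+1 -> x \in pow_submod k.
Proof.
move=> /asboolP[s sP ->]; apply/asboolP; exists s => // p /sP[pa pM].
by split=> //; exact: ideal_powS_sub pa.
Qed.

Definition pow_proj (k : nat) :
    {linear quotmod (pow_submod k.+1) -> quotmod (pow_submod k)} :=
  @quot_map R M M _ _ idfun (@pow_submodS k).

End GeneralizedLocalCohomology.

Definition gen_loc_cohom (R : comNzRingType) (i : nat) (a : ideal R)
    (M X : lmodType R) : lmodType R :=
  @dirlim R (fun k => Ext i (quotmod (pow_submod a M k)) X)
    (fun k => Ext_map X (pow_proj a M k) i).

(* Main.v *)
Require Import Defs.
From HB Require Import structures.
From mathcomp Require Import all_boot all_algebra.
From mathcomp Require Import boolp classical_sets functions cardinality fsbigop finmap.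

Set Implicit Arguments.
Unset Strict Implicit.
Unset Printing Implicit Defensive.

Import GRing.Theory.
Local Open Scope ring_scope.

Local Notation Hom := Defs.Hom.
Local Notation free := Defs.free.

(** Write [b = a + ann M] and [H i X] for the generalized local cohomology of
    [M] and [X]. An Artinian module is supported at maximal ideals only
    ([artinian_dim0]), so the content of the theorem is that dimension zero
    forces Artinianness and cofiniteness.

    The proof takes place in the class [fin_socle] of the Artinian modules [T]
    for which the part [0 :_T b] killed by [b] has finite length. Two facts make
    it convenient. It is closed under submodules, quotients and extensions
    ([fin_socle_serre]), so that [Ext i (R / b) T], a subquotient of a finite
    power of [T] that is killed by [b], has finite length when [T] is in the
    class; hence members of the class are cofinite as soon as they are
    [b]-torsion ([cohom_cofinite]). And a [b]-torsion module [T] belongs to it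
    if [0 :_T x] does for a single [x] in [b] ([fin_socle_tors]), by
    Melkersson's criterion [artinian_tors].

    That [H i X] is in the class for [i <= n] when it has dimension zero there
    is proved by induction on [n] ([cohom_induction]). The [b]-torsion
    submodule [G] of [X] has dimension zero because [H 0 X] has
    ([Gamma_dim0]), hence finite length. A power of [a] kills [G], and then
    [H i G] is a subquotient of a finite power of [G] ([torsion_coef_subquo],
    through the Artin-Rees property): it has finite length too. So [X] may be
    replaced by [X' = X / G], on which some [x] in [b] is regular
    ([regular_element]). In the long exact sequence of
    [0 -> X' -> X' -> X' / x X' -> 0], the modules [H i (X' / x X')] have
    dimension zero for [i < n], so they are in the class by induction, and the
    connecting map sends [H i (X' / x X')] onto the part of [H i.+1 X'] killed
    by [x].

    Long exact sequences are needed in the coefficients only, where they come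
    for free from the standard resolutions. Their maps, and more generally all
    presentations of a module as a subquotient, are handled as linear
    relations, which spares the choice of representatives. *)

(** * Submodules and linear relations *)

Definition linear_set (R : comNzRingType) (M : lmodType R) (P : M -> Prop) :=
  P 0 /\ forall c x y, P x -> P y -> P (c *: x + y).

Section SubmoduleOfProp.
Variables (R : comNzRingType) (M : lmodType R) (P : M -> Prop).
Hypothesis linP : linear_set P.

Definition prop_pred & linear_set P : {pred M} := fun x => `[< P x >].

Fact prop_pred_closed : submod_closed (prop_pred linP).
Proof.
split=> [|c x y]; first by apply/asboolP; exact: linP.1.
by move=> /asboolP Px /asboolP Py; apply/asboolP; exact: linP.2.
Qed.
HB.instance Definition _ :=
  GRing.isSubmodClosed.Build R M (prop_pred linP)
    (GRing.submod_closed_semi prop_pred_closed).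
Definition mksub : submodClosed M := prop_pred linP.

Lemma mksubP x : (x \in mksub) <-> P x.
Proof. by split=> [/asboolP|Px]; last exact/asboolP. Qed.

End SubmoduleOfProp.

Section LinearSet.
Variables (R : comNzRingType) (M : lmodType R).

Lemma linear_set_mem (N : submodClosed M) : linear_set (fun x => x \in N).
Proof. by split=> [|c x y xN yN]; rewrite ?rpred0 ?rpredD ?rpredZ. Qed.

Lemma memB (N : submodClosed M) x y : x \in N -> y \in N -> x - y \in N.
Proof. by move=> xN yN; rewrite rpredD // -scaleN1r rpredZ. Qed.

Lemma linear_setZ (P : M -> Prop) c x : linear_set P -> P x -> P (c *: x).
Proof. by move=> [P0 PL] Px; rewrite -[_ *: _]addr0; exact: PL. Qed.

Lemma linear_setD (P : M -> Prop) x y :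
  linear_set P -> P x -> P y -> P (x + y).
Proof. by move=> [P0 PL] Px Py; rewrite -[x]scale1r; exact: PL. Qed.

Lemma linear_setB (P : M -> Prop) x y :
  linear_set P -> P x -> P y -> P (x - y).
Proof. by move=> [P0 PL] Px Py; rewrite addrC -scaleN1r; exact: PL. Qed.

Lemma linear_set_preim (N : lmodType R) (f : {linear M -> N}) (P : N -> Prop) :
  linear_set P -> linear_set (fun x => P (f x)).
Proof.
move=> [P0 PL]; split=> [|c x y Px Py]; first by rewrite linear0.
by rewrite linearP; exact: PL.
Qed.

Lemma linear_set_im (N : lmodType R) (f : {linear M -> N}) (P : M -> Prop) :
  linear_set P -> linear_set (fun y => exists2 x, P x & y = f x).
Proof.
move=> [P0 PL]; split=> [|c _ _ [x Px ->] [y Py ->]].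
  by exists 0; rewrite ?linear0.
by exists (c *: x + y); [exact: PL | rewrite linearP].
Qed.

Lemma linear_set_ker (N : lmodType R) (f : {linear M -> N}) :
  linear_set (fun x => f x = 0).
Proof.
split=> [|c x y fx fy]; first exact: linear0.
by rewrite linearP fx fy scaler0 addr0.
Qed.

Lemma linear_set_tors (x : R) : linear_set (fun t : M => x *: t = 0).
Proof.
split=> [|c t u tx ux]; first exact: scaler0.
by rewrite scalerDr ux scalerA mulrC -scalerA tx scaler0 addr0.
Qed.

End LinearSet.

Section LinearRelation.
Variables (R : comNzRingType).

Definition linear_rel (V U : lmodType R) (Q : V -> U -> Prop) :=
  Q 0 0 /\ forall c v v' u u', Q v u -> Q v' u' -> Q (c *: v + v') (c *: u + u').

Section Ops.
Variables (V U : lmodType R) (Q : V -> U -> Prop) (lQ : linear_rel Q).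

Lemma linear_relB v v' u u' : Q v u -> Q v' u' -> Q (v - v') (u - u').
Proof. by move=> ? ?; rewrite ![_ - _]addrC -2!scaleN1r; exact: lQ.2. Qed.

Lemma linear_relD v v' u u' : Q v u -> Q v' u' -> Q (v + v') (u + u').
Proof. by move=> ? ?; rewrite -[v]scale1r -[u]scale1r; exact: lQ.2. Qed.

Lemma linear_relZ c v u : Q v u -> Q (c *: v) (c *: u).
Proof.
by move=> ?; rewrite -[c *: v]addr0 -[c *: u]addr0; apply: lQ.2 => //; exact: lQ.1.
Qed.

Lemma linear_rel_sum n (c : 'I_n -> R) (v : 'I_n -> V) (u : 'I_n -> U) :
  (forall i, Q (v i) (u i)) -> Q (\sum_i c i *: v i) (\sum_i c i *: u i).
Proof.
move=> Qvu; apply: (big_ind2 (fun x y => Q x y)) => [|x1 x2 y1 y2|i _].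
- exact: lQ.1.
- exact: linear_relD.
- exact: linear_relZ.
Qed.

Lemma linear_set_relp u : u = 0 -> linear_set (Q^~ u).
Proof.
move=> ->; split=> [|c x y Qx Qy]; first exact: lQ.1.
by have := lQ.2 c _ _ _ _ Qx Qy; rewrite scaler0 addr0.
Qed.

Lemma linear_set_relpreim (P : U -> Prop) :
  linear_set P -> linear_set (fun v => exists2 u, P u & Q v u).
Proof.
move=> [P0 PL]; split=> [|c x y [v Pv Qv] [w Pw Qw]].
  by exists 0 => //; exact: lQ.1.
by exists (c *: v + w); [exact: PL | exact: lQ.2].
Qed.

End Ops.

Lemma linear_rel_fun (V U : lmodType R) (f : {linear V -> U}) :
  linear_rel (fun v u => u = f v).
Proof.
by split=> [|c v v' u u' -> ->]; rewrite ?linear0 ?linearP.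
Qed.

Lemma linear_rel_submod (V U : lmodType R) (Q : V -> U -> Prop)
    (N : submodClosed U) :
  linear_rel Q -> linear_rel (fun v (u : submod N) => Q v (val u)).
Proof. by move=> lQ; split=> [|c v v' u u']; [exact: lQ.1 | exact: lQ.2]. Qed.

(** A linear relation from [V] onto [U] that relates [0] only to [0] presents
    [U] as a quotient of its domain, a submodule of [V]. Relations keep
    connecting homomorphisms usable without choosing the liftings that define
    them. *)
Definition subquo (V U : lmodType R) := exists Q : V -> U -> Prop,
  [/\ linear_rel Q, forall u, exists v, Q v u & forall u, Q 0 u -> u = 0].

Definition serre (P : lmodType R -> Prop) :=
  (forall V U, subquo V U -> P V -> P U) /\
  (forall (U : lmodType R) (N : submodClosed U), P (submod N) -> P (quotmod N) -> P U).

Lemma subquo_inj (V U : lmodType R) (f : {linear U -> V}) :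
  injective f -> subquo V U.
Proof.
move=> fI; exists (fun v u => v = f u); split.
- by split=> [|c v v' u u' -> ->]; rewrite ?linear0 ?linearP.
- by move=> u; exists (f u).
- by move=> u u0; apply: fI; rewrite -u0 linear0.
Qed.

Lemma subquo_surj (V U : lmodType R) (f : {linear V -> U}) :
  (forall u, exists v, f v = u) -> subquo V U.
Proof.
move=> fS; exists (fun v u => u = f v); split; first exact: linear_rel_fun.
- by move=> u; have [v <-] := fS u; exists v.
- by move=> u ->; exact: linear0.
Qed.

Lemma subquo_submod (U : lmodType R) (N : submodClosed U) : subquo U (submod N).
Proof. by apply: (@subquo_inj _ _ (\val : submod N -> U)); exact: val_inj. Qed.

Lemma quot_pi_eq0 (U : lmodType R) (N : submodClosed U) x :
  quot_pi N x = 0 <-> x \in N.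
Proof.
by rewrite -(linear0 (quot_pi N)) -{2}[x]subr0 -quot_piE; split=> /eqP.
Qed.

Lemma subquo_quotmod (U : lmodType R) (N : submodClosed U) :
  subquo U (quotmod N).
Proof.
apply: (@subquo_surj _ _ (quot_pi N)) => q.
by exists (quot_repr q); exact: quot_reprK.
Qed.

(** The elements that [Q2] relates to [0] form a submodule of [U], which [Q1]
    presents as a subquotient of [A]; and [Q2] presents the quotient by it as a
    subquotient of [B]. This is an exact sequence [A -> U -> B] whose maps are
    relations. *)
Lemma serre_exact (P : lmodType R -> Prop) (A U B : lmodType R)
    (Q1 : A -> U -> Prop) (Q2 : U -> B -> Prop) :
  serre P -> linear_rel Q1 -> linear_rel Q2 ->
  (forall u, exists b, Q2 u b) -> (forall u, Q2 u 0 -> exists a, Q1 a u) ->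
  (forall u, Q1 0 u -> u = 0) -> P A -> P B -> P U.
Proof.
move=> [Psq Pext] l1 l2 tot2 ex1 inj1 PA PB.
pose N := mksub (linear_set_relp l2 erefl).
apply: (Pext _ N).
  apply: Psq PA; exists (fun a u => Q1 a (val u)); split.
  - exact: linear_rel_submod.
  - by move=> u; apply: ex1; apply/(mksubP (linear_set_relp l2 erefl))/valP.
  - by move=> u /inj1 u0; exact: val_inj.
apply: Psq PB; exists (fun b q => exists2 u, q = quot_pi N u & Q2 u b); split.
- split=> [|c v v' q q' [u -> Qu] [u' -> Qu']].
    by exists 0; rewrite ?linear0 //; exact: l2.1.
  by exists (c *: u + u'); rewrite ?linearP //; exact: l2.2.
- move=> q; have [b Qb] := tot2 (quot_repr q); exists b.
  by exists (quot_repr q) => //; apply/esym; exact: quot_reprK.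
- by move=> q [u -> Qu]; apply/quot_pi_eq0/mksubP.
Qed.

Lemma serre0 (P : lmodType R -> Prop) (V U : lmodType R) :
  serre P -> P V -> (forall u : U, u = 0) -> P U.
Proof.
move=> [Psq _] PV U0; apply: Psq PV; exists (fun v u => v = 0 /\ u = 0); split.
- by split=> // c v v' u u' [-> ->] [-> ->]; rewrite !scaler0 !addr0.
- by move=> u; exists 0; rewrite (U0 u).
- by move=> u [].
Qed.

Lemma serre_pow (P : lmodType R -> Prop) (T : lmodType R) m :
  serre P -> P T -> P ({ffun 'I_m -> T} : lmodType R).
Proof.
move=> sP PT; elim: m => [|m IHm].
  by apply: serre0 sP PT _ => u; apply/ffunP => -[].
apply: (@serre_exact P {ffun 'I_m -> T} {ffun 'I_m.+1 -> T} T
  (fun a u => u ord0 = 0 /\ forall i, u (lift ord0 i) = a i)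
  (fun u b => b = u ord0)) => //.
- split=> [|c v v' u u' [u0 uE] [u'0 u'E]].
    by split=> [|i]; rewrite !ffunE.
  by split=> [|i]; rewrite !ffunE ?u0 ?u'0 ?scaler0 ?addr0 // uE u'E.
- by split=> [|c v v' u u' -> ->]; rewrite !ffunE.
- by move=> u; exists (u ord0).
- by move=> u u0; exists [ffun i => u (lift ord0 i)]; split=> // i; rewrite ffunE.
- move=> u [u0 uE]; apply/ffunP => i; rewrite ffunE.
  by have [j ->|->//] := unliftP ord0 i; rewrite uE ffunE.
Qed.

End LinearRelation.

(** * Noetherian modules, Artinian modules and modules of dimension zero *)

Section Noetherian.
Variable R : comNzRingType.
Implicit Types T U V : lmodType R.

Definition fg_sub T (N : submodClosed T) := exists n (g : 'I_n -> T),
  (forall i, g i \in N) /\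
  forall x, x \in N -> exists c : 'I_n -> R, x = \sum_i c i *: g i.

Lemma val_sum T (N : submodClosed T) n (c : 'I_n -> R) (g : 'I_n -> submod N) :
  val (\sum_i c i *: g i) = \sum_i c i *: val (g i).
Proof. by rewrite (linear_sum (\val : submod N -> T)). Qed.

Lemma fg_subP T (N : submodClosed T) : fg_sub N <-> fin_gen (submod N).
Proof.
split=> [[n [g [gN gE]]]|[n [g gE]]].
  exists n, (fun i => Submod (gN i)) => x; have [c xE] := gE _ (valP x).
  by exists c; apply: val_inj; rewrite val_sum.
exists n, (fun i => val (g i)); split=> [i|x xN]; first exact: valP.
by have [c /(congr1 val) xE] := gE (Submod xN); exists c; rewrite -val_sum -xE.
Qed.

Definition noeth T := forall N : submodClosed T, fg_sub N.

Lemma noeth_serre : serre noeth.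
Proof.
split=> [V U [Q [lQ tot inj]] nV N|U W nW nQ N].
  pose lP := linear_set_relpreim lQ (linear_set_mem N).
  have [n [v [vN vE]]] := nV (mksub lP).
  have /choice[u uN] i : exists u, u \in N /\ Q (v i) u.
    by have /mksubP[u uN Qu] := vN i; exists u.
  exists n, u; split=> [i|x xN]; first by have [] := uN i.
  have [w Qwx] := tot x.
  have /vE[c wE] : w \in mksub lP by apply/mksubP; exists x.
  exists c; apply/eqP; rewrite -subr_eq0; apply/eqP/inj.
  rewrite -(subrr w) {2}wE; apply: linear_relB => //.
  by apply: linear_rel_sum => // i; have [] := uN i.
pose l1 := linear_set_preim (\val : submod W -> U) (linear_set_mem N).
have [m [g [gN gE]]] := nW (mksub l1).
pose l2 := linear_set_im (quot_pi W) (linear_set_mem N).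
have [n [h [hN hE]]] := nQ (mksub l2).
have /choice[k kN] i : exists u, u \in N /\ h i = quot_pi W u.
  by have /mksubP[u uN hu] := hN i; exists u.
exists (m + n)%N, (fun i => match fintype.split i with
  inl j => val (g j) | inr j => k j end).
split=> [i|x xN].
  case: fintype.split => j; last by have [] := kN j.
  exact/(mksubP l1).
have /hE[c cE] : quot_pi W x \in mksub l2 by apply/mksubP; exists x.
have xcW : x - \sum_i c i *: k i \in W.
  apply/quot_pi_eq0; rewrite linearB linear_sum /= cE.
  apply/eqP; rewrite subr_eq0; apply/eqP/eq_bigr => i _.
  by rewrite linearZ /=; have [_ <-] := kN i.
have xcN : x - \sum_i c i *: k i \in N.
  by apply: memB => //; apply: rpred_sum => i _; apply/rpredZ; have [] := kN i.
have [|d dE] := gE (Submod xcW); first exact/(mksubP l1)/xcN.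
exists (fun i => match fintype.split i with inl j => d j | inr j => c j end).
rewrite big_split_ord /= -[LHS](subrK (\sum_i c i *: k i)); congr (_ + _).
  have /(congr1 val) /= -> := dE; rewrite val_sum; apply: eq_bigr => i _.
  by rewrite (unsplitK (inl _ i)).
by apply: eq_bigr => i _; rewrite (unsplitK (inr _ i)).
Qed.

Lemma noeth_fin_gen T : noeth T -> fin_gen T.
Proof.
move=> /(_ (full_submod T))[n [g [_ gE]]].
by exists n, g => x; apply: gE.
Qed.

Lemma fin_gen_noeth T : noetherian_ring R -> fin_gen T -> noeth T.
Proof.
move=> nR [n [g gE]].
have nRo : noeth R^o by move=> N; apply/fg_subP/nR.
apply: (noeth_serre.1 _ _ _ (serre_pow n noeth_serre nRo)).
exists (fun (v : {ffun 'I_n -> R^o}) t => t = \sum_i (v i : R) *: g i); split.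
- split=> [|c v v' u u' -> ->].
    by rewrite big1 // => i _; rewrite ffunE scale0r.
  rewrite scaler_sumr -big_split; apply: eq_bigr => i _.
  by rewrite !ffunE scalerDl scalerA.
- move=> t; have [c ->] := gE t; exists [ffun i => c i].
  by apply: eq_bigr => i _; rewrite ffunE.
- by move=> t ->; rewrite big1 // => i _; rewrite ffunE scale0r.
Qed.

(** The submodules of a Noetherian module satisfy the ascending chain
    condition, because a finite generating set of the union of a chain lies in
    one of its members; dependent choice then gives a maximal member of any
    nonempty family. *)
Lemma noeth_max T (F : submodClosed T -> Prop) N0 : noeth T -> F N0 ->
  exists N, [/\ F N, forall x, x \in N0 -> x \in N &
    forall L, F L -> (forall x, x \in N -> x \in L) ->
              forall x, x \in L -> x \in N].
Proof.
move=> nT F0.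
pose G := {N | F N /\ forall x, x \in N0 -> x \in N}.
apply: contrapT => nex.
have /choice[s sP] (N : G) : exists L : G,
    (forall x, x \in sval N -> x \in sval L) /\
    exists2 x, x \in sval L & x \notin sval N.
  case: N => N /= [FN NN0]; apply: contrapT => nL; apply: nex; exists N.
  split=> // L FL NL x xL; apply: contrapT => /negP xN; apply: nL.
  have NL0 : forall y, y \in N0 -> y \in L by move=> y /NN0/NL.
  by exists (exist _ L (conj FL NL0)); split=> //; exists x.
pose C k := sval (iter k s (exist _ N0 (conj F0 (fun x h => h)))).
have CS k l x : x \in C k -> x \in C (l + k)%N.
  elim: l => // l IH /IH; exact: (sP _).1.
have lC : linear_set (fun x => exists k, x \in C k).
  split=> [|c x y [k xk] [l yl]]; first by exists 0%N; rewrite rpred0.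
  exists (k + l)%N; apply: rpredD; last exact: CS.
  by apply: rpredZ; rewrite addnC; exact: CS.
have [n [g [gC gE]]] := nT (mksub lC).
have Ck i : exists k : nat, g i \in C k := (mksubP lC _).1 (gC i).
have [k kP] := choice Ck.
pose K := (\sum_i k i)%N.
have gK i : g i \in C K.
  by rewrite /K (bigD1 i) //= addnC; exact/CS/kP.
have [_ [x xS xN]] := sP (iter K s (exist _ N0 (conj F0 (fun x h => h)))).
have /gE[c xE] : x \in mksub lC by apply/mksubP; exists K.+1.
by move: xN; rewrite -/(C K) xE rpred_sum // => i _; apply/rpredZ/gK.
Qed.

Lemma noeth_chain T (N : nat -> T -> Prop) :
  noeth T -> (forall k, linear_set (N k)) -> (forall k x, N k x -> N k.+1 x) ->
  exists K, forall k x, N k x -> N K x.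
Proof.
move=> nT lN NS.
have [L [[K LE] _ Lmax]] := @noeth_max T
  (fun L => exists k, forall x, x \in L <-> N k x) _ nT
  (ex_intro _ 0%N (fun x => mksubP (lN 0%N) x)).
have NSl k l x : N k x -> N (l + k)%N x by elim: l => // l IH /IH /NS.
exists K => k x Nx; apply/LE/(Lmax (mksub (lN (K + k)%N))).
- by exists (K + k)%N => y; apply: mksubP.
- by move=> y /LE Ny; apply/mksubP; rewrite addnC; exact: NSl.
- by apply/mksubP; exact: NSl.
Qed.

End Noetherian.

Section Artinian.
Variable R : comNzRingType.
Implicit Types T U V : lmodType R.

Lemma artinian_chain T (N : nat -> T -> Prop) :
  artinian T -> (forall k, linear_set (N k)) -> (forall k x, N k.+1 x -> N k x) ->
  exists K, forall k x, (K <= k)%N -> N K x -> N k x.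
Proof.
move=> aT lN NS; have [|K KE] := aT (fun k => mksub (lN k)).
  by move=> k x /mksubP/NS Nx; apply/mksubP.
by exists K => k x Kk Nx; apply/(mksubP (lN k)); rewrite KE //; exact/mksubP.
Qed.

Lemma artinianP T :
  (forall N : nat -> T -> Prop,
     (forall k, linear_set (N k)) -> (forall k x, N k.+1 x -> N k x) ->
     exists K, forall k x, (K <= k)%N -> N K x -> N k x) ->
  artinian T.
Proof.
move=> aT N NS; have [k|//|K KP] := aT (fun k x => x \in N k).
  exact: linear_set_mem.
have NSl k l x : x \in N (l + k)%N -> x \in N k by elim: l => // l IH /NS /IH.
exists K => k Kk x; apply/idP/idP; last exact: KP.
by rewrite -(subnK Kk) => /NSl.
Qed.

Lemma artinian_serre : serre (@artinian R).
Proof.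
split=> [V U [Q [lQ tot inj]] aV|U W aW aQ]; apply: artinianP => N lN NS.
  have [||K KP] := artinian_chain (N := fun k v => exists2 u, N k u & Q v u) aV.
  - by move=> k; exact: linear_set_relpreim.
  - by move=> k v [u /NS Nu Qu]; exists u.
  exists K => k x Kk Nx; have [v Qvx] := tot x.
  have [|u Nu Qu] := KP k v Kk; first by exists x.
  suff -> : x = u by [].
  by apply/eqP; rewrite -subr_eq0; apply/eqP/inj; rewrite -(subrr v);
    exact: linear_relB.
have [||K1 K1P] := artinian_chain (N := fun k v => N k (val v)) aW.
- by move=> k; exact: (linear_set_preim (\val : submod W -> U)).
- by move=> k v; exact: NS.
have [||K2 K2P] :=
  artinian_chain (N := fun k q => exists2 u, N k u & q = quot_pi W u) aQ.
- by move=> k; exact: linear_set_im.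
- by move=> k q [u /NS Nu ->]; exists u.
have NSle k l x : (k <= l)%N -> N l x -> N k x.
  by move=> kl; rewrite -(subnK kl); elim: (_ - _)%N => // m IH /NS /IH.
exists (K1 + K2)%N => k x Kk Nx.
have K1k := leq_trans (leq_addr K2 K1) Kk.
have [|u Nu] := K2P k (quot_pi W x) (leq_trans (leq_addl _ _) Kk).
  by exists x => //; apply: NSle Nx; exact: leq_addl.
move=> /eqP; rewrite quot_piE => xuW.
rewrite -(subrK u x); apply: linear_setD => //.
apply: (K1P k (Submod xuW) K1k) => /=.
apply: linear_setB => //; last exact: NSle Nu.
by apply: NSle Nx; exact: leq_addr.
Qed.

End Artinian.

Section DimensionZero.
Variable R : comNzRingType.
Implicit Types T U V : lmodType R.

Lemma suppP T (p : prime_idealr R) :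
  supp T p <-> exists x : T, forall t : R, t \notin p -> t *: x <> 0.
Proof.
split=> [[x [s [sp nfr]]]|[x xP]].
  exists x => t tp tx0; apply: nfr; exists t => //=.
  by rewrite scale1r scaler0 subr0.
exists x, 1; split; first by rewrite idealr1.
move=> [t tp /=]; rewrite scale1r scaler0 subr0; exact: xP.
Qed.

Lemma supp_up T (p q : prime_idealr R) :
  {subset p <= q} -> supp T p -> supp T q.
Proof.
move=> pq /suppP[x xP]; apply/suppP; exists x => t tq; apply: xP.
by apply: contra tq => /pq.
Qed.

(** Supports are stable under enlarging primes, so a chain of length one in the
    support is just a non-maximal prime of the support. *)
Lemma dim_le0P T : dim_le T 0 <-> forall p q : prime_idealr R,
  supp T p -> {subset p <= q} -> {subset q <= p}.
Proof.
split=> [d0 p q pT pq x xq|PT [//|n] [p [pS pT]]].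
  apply: contrapT => xp; have : (1 <= 0)%N; last by [].
  apply: d0; exists (fun i => if i is 0%N then p else q); split.
    by case=> // _; split=> // qp; apply: xp; exact: qp.
  by case=> [|[|//]] _ //; exact: supp_up pT.
have [p01 np10] := pS 0%N isT; case: np10; apply: PT p01; exact: pT.
Qed.

Lemma dim0_serre : serre (fun T : lmodType R => dim_le T 0).
Proof.
split=> [V U [Q [lQ tot inj]] /dim_le0P dV|U W /dim_le0P dW /dim_le0P dQ].
  apply/dim_le0P => p q /suppP[u uP]; apply: dV; apply/suppP.
  have [v Qvu] := tot u; exists v => t tp tv; apply: (uP t tp).
  by apply: inj; rewrite -tv; exact: linear_relZ.
apply/dim_le0P => p q /suppP[u uP].
have [qP|/existsNP[t /not_implyP[tp /contrapT tu]]] :=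
    pselect (forall t, t \notin p -> t *: quot_pi W u <> 0).
  by apply: dQ; apply/suppP; exists (quot_pi W u).
have tuW : t *: u \in W by apply/quot_pi_eq0; rewrite linearZ.
apply: dW; apply/suppP; exists (Submod tuW) => s sp /(congr1 val) /= stu.
by apply: (uP (s * t)); rewrite ?prime_idealrM ?negb_or ?sp // -scalerA.
Qed.

(** Let the annihilator of [x] lie in [p], and let [r] be in a larger prime [q]
    but not in [p]. The submodules [R r ^ k x] decrease, and stability gives
    [1 - c r] in [p] for some [c], which would put [1] in [q]. *)
Lemma artinian_dim0 T : artinian T -> dim_le T 0.
Proof.
move=> aT; apply/dim_le0P => p q /suppP[x xP] pq r rq; apply: contrapT => /negP rp.
have [||K KP] := artinian_chain (N := fun k t => exists c : R, t = (c * r ^+ k) *: x) aT.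
- move=> k; split=> [|c _ _ [d ->] [e ->]]; first by exists 0; rewrite mul0r scale0r.
  by exists (c * d + e); rewrite mulrDl scalerDl scalerA mulrA.
- by move=> k t [c ->]; exists (c * r); rewrite exprS mulrA.
have [|c cE] := KP K.+1 (r ^+ K *: x) (leqnSn K); first by exists 1; rewrite mul1r.
have rKp : r ^+ K \notin p.
  elim: (K) => [|k IH]; last by rewrite exprS prime_idealrM negb_or rp.
  by rewrite idealr1.
have [crp|ncrp] := boolP (1 - c * r \in p).
  suff: (1 : R) \in q by rewrite idealr1.
  by rewrite -(subrK (c * r) 1) rpredD ?(pq _ crp) // idealMr.
apply: (xP ((1 - c * r) * r ^+ K)).
  by rewrite prime_idealrM negb_or ncrp.
by rewrite mulrBl mul1r scalerBl -mulrA -exprS -cE subrr.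
Qed.

End DimensionZero.

(** * Artinian modules with a finitely generated annihilated part *)

Section Torsion.
Variable R : comNzRingType.
Implicit Types T U V : lmodType R.

Definition tors (x : R) T : lmodType R := submod (mksub (linear_set_tors T x)).

Lemma tors_val x T (t : tors x T) : x *: val t = 0.
Proof. exact/(mksubP (linear_set_tors T x))/valP. Qed.

Definition mktors x T (t : T) (xt : x *: t = 0) : tors x T :=
  Submod ((mksubP (linear_set_tors T x) t).2 xt).

Lemma linear_set_mul T (x : R) : linear_set (fun y : T => exists t, y = x *: t).
Proof.
split=> [|c _ _ [s ->] [t ->]]; first by exists 0; rewrite scaler0.
by exists (c *: s + t); rewrite scalerDr !scalerA mulrC.
Qed.

Lemma serre_torsX (P : lmodType R -> Prop) T x k :
  serre P -> P (tors x T) -> P (tors (x ^+ k) T).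
Proof.
move=> sP PT; elim: k => [|k IHk].
  apply: serre0 sP PT _ => u; apply: val_inj.
  by rewrite -[LHS]scale1r -[X in X *: _](expr0 x); exact: tors_val.
apply: (@serre_exact _ P (tors x T) (tors (x ^+ k.+1) T) (tors (x ^+ k) T)
  (fun a u => val u = val a) (fun u b => val b = x *: val u)) => //.
- by split=> [|c v v' u u' /= -> ->].
- split=> [|c v v' u u' /= -> ->]; first by rewrite /= scaler0.
  by rewrite scalerDr !scalerA mulrC.
- move=> u; have xu : x ^+ k *: (x *: val u) = 0.
    by rewrite scalerA -exprSr; exact: tors_val.
  by exists (mktors xu).
- by move=> u /= /esym xu; exists (mktors xu).
- by move=> u /= u0; exact: val_inj.
Qed.

(** The images of the powers of [x] stabilize, and then
    [T = x T + (0 :_T x ^ k)], so that [T / x T] is a quotient of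
    [0 :_T x ^ k]. *)
Lemma serre_coker (P : lmodType R -> Prop) T x :
  serre P -> artinian T -> P (tors x T) ->
  P (quotmod (mksub (linear_set_mul T x))).
Proof.
move=> sP aT PT.
have [||k kP] := artinian_chain (N := fun k t => exists s, t = x ^+ k *: s) aT.
- by move=> k; exact: linear_set_mul.
- by move=> k _ [s ->]; exists (x *: s); rewrite exprSr scalerA.
apply: sP.1 (serre_torsX k sP PT).
exists (fun v q => q = quot_pi _ (val v)); split.
- by split=> [|c v v' q q' -> ->]; rewrite ?linear0 ?linearP.
- move=> q; have [||s sE] := kP (k + k.+1)%N (x ^+ k *: quot_repr q).
  + exact: leq_addr.
  + by exists (quot_repr q).
  have vP : x ^+ k *: (quot_repr q - x ^+ k.+1 *: s) = 0.
    by rewrite scalerBr sE exprD scalerA subrr.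
  exists (mktors vP); rewrite /= -[LHS]quot_reprK; apply/eqP.
  rewrite quot_piE; apply/mksubP; exists (x ^+ k *: s).
  by rewrite scalerA -exprS opprB addrCA subrr addr0.
- by move=> q ->; exact: linear0.
Qed.

(** Closure under a quotient [V / K] uses the exact sequence
    [0 :_V x -> 0 :_(V / K) x -> K / x K] and the previous lemma. *)
Lemma serre_tors (P : lmodType R -> Prop) x :
  serre P -> serre (fun T => artinian T /\ P (tors x T)).
Proof.
move=> sP; split=> [V U sVU [aV PV]|U W [aW PW] [aQ PQ]].
  split; first exact: (artinian_serre R).1 sVU aV.
  have [Q [lQ tot inj]] := sVU.
  pose lK := linear_set_relp lQ (erefl 0); pose K := mksub lK.
  have PK : P (tors x (submod K)).
    apply: sP.1 PV; exists (fun v u => v = mktors (tors_val v) /\ val v = val (val u)).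
    split.
    - split=> [|c v v' u u' [_ vu] [_ vu']]; split=> //; try exact: val_inj.
      by rewrite /= vu vu'.
    - move=> u; have xu : x *: val (val u) = 0.
        by have /(congr1 val) := tors_val u.
      by exists (mktors xu); split=> //; exact: val_inj.
    - by move=> u [_ /esym u0]; apply: val_inj; apply: val_inj.
  have aK : artinian (submod K).
    exact: (artinian_serre R).1 (subquo_submod K) aV.
  apply: (@serre_exact _ P (tors x V) (tors x U)
    (quotmod (mksub (linear_set_mul (submod K) x)))
    (fun a u => Q (val a) (val u))
    (fun u b => exists v k, [/\ Q v (val u), x *: v = val k & b = quot_pi _ k])) => //.
  - by split=> [|c v v' u u']; [exact: lQ.1 | exact: lQ.2].
  - split=> [|c u u' b b' [v [k [Qv vk ->]]] [v' [k' [Qv' vk' ->]]]].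
      by exists 0, 0; split; rewrite ?linear0 ?scaler0 //; exact: lQ.1.
    exists (c *: v + v'), (c *: k + k').
    split; [exact: lQ.2 | | by rewrite linearP].
    by rewrite /= -vk -vk' scalerDr !scalerA mulrC.
  - move=> u; have [v Qv] := tot (val u).
    have xvK : x *: v \in K.
      by apply/mksubP; rewrite -(tors_val u); exact: linear_relZ.
    by exists (quot_pi _ (Submod xvK)), v, (Submod xvK).
  - move=> u [v [k [Qv vk /esym/quot_pi_eq0/mksubP[l kl]]]].
    have xvl : x *: (v - val l) = 0.
      by rewrite scalerBr vk kl /= subrr.
    exists (mktors xvl); rewrite /= -[val u]subr0; apply: linear_relB => //.
    exact/(mksubP lK)/(valP l).
  - by move=> u /inj u0; exact: val_inj.
  - exact: serre_coker.
split; first exact: (artinian_serre R).2 aW aQ.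
apply: (@serre_exact _ P (tors x (submod W)) (tors x U) (tors x (quotmod W))
  (fun a u => val u = val (val a)) (fun u b => val b = quot_pi W (val u))) => //.
- by split=> [|c v v' u u' /= -> ->].
- split=> [|c v v' u u' /= -> ->]; first by rewrite /= linear0.
  by rewrite -linearP.
- move=> u; have xu : x *: quot_pi W (val u) = 0.
    by rewrite -linearZ /= tors_val linear0.
  by exists (mktors xu).
- move=> u /esym/quot_pi_eq0 uW.
  have xu : x *: (Submod uW : submod W) = 0.
    by apply: val_inj; rewrite /= tors_val.
  by exists (mktors xu).
- by move=> u u0; exact: val_inj.
Qed.

(** Melkersson's criterion for a principal ideal. The sets
    [x ^ e (N k :&: (0 :_T x ^ e.+1))] decrease in both [k] and [e] inside the
    Artinian module [0 :_T x], so they are all stationary from some common [k]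
    on, and they determine the [N k] because [T] is [x]-torsion. *)
Lemma artinian_tors T x :
  (forall t : T, exists k, x ^+ k *: t = 0) -> artinian (tors x T) ->
  artinian T.
Proof.
move=> tT aT; apply: artinianP => N lN NS.
have NSle k l t : (k <= l)%N -> N l t -> N k t.
  by move=> kl; rewrite -(subnK kl); elim: (_ - _)%N => // m IH /NS /IH.
pose G k e (u : tors x T) := exists t, N k t /\ val u = x ^+ e *: t.
have lG k e : linear_set (G k e).
  split=> [|c u v [s [Ns us]] [t [Nt vt]]].
    by exists 0; split; [exact: (lN k).1 | rewrite scaler0].
  exists (c *: s + t); split; first exact: (lN k).2.
  by rewrite /= us vt scalerDr !scalerA mulrC.
have GS k e u : G k.+1 e u -> G k e u.
  by move=> [t [/NS Nt ut]]; exists t.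
have GSe k e u : G k e.+1 u -> G k e u.
  move=> [t [Nt ut]]; exists (x *: t).
  by rewrite ut exprSr scalerA; split=> //; exact: linear_setZ.
have Gle k l e f u : (k <= l)%N -> (e <= f)%N -> G l f u -> G k e u.
  move=> kl ef; rewrite -(subnK kl) -(subnK ef).
  elim: (l - k)%N => [|m IH] /=; last by move=> /GS.
  by elim: (f - e)%N => // m IH /GSe.
have [||d dP] := artinian_chain (N := fun k => G k k) aT.
- by move=> k; exact: lG.
- by move=> k u /GS /GSe.
(* the diagonal settles all [e >= d]; finitely many [e] remain *)
have [K KP] : exists K, forall e, (e < d)%N -> forall k u, G K e u -> G k e u.
  elim: (d) => [|f [K KP]]; first by exists 0%N.
  have [||L LP] := artinian_chain (N := fun k => G k f) aT.
  - by move=> k; exact: lG.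
  - by move=> k u /GS.
  exists (maxn K L) => e; rewrite ltnS leq_eqVlt => /orP[/eqP->|ef] k u Gu.
    have [kL|Lk] := leqP L k; first by apply: LP => //; apply: Gle Gu => //; exact: leq_maxr.
    by apply: Gle Gu => //; apply: leq_trans (ltnW Lk) _; exact: leq_maxr.
  by apply: KP => //; apply: Gle Gu => //; exact: leq_maxl.
pose m := maxn K d.
have mP e k u : G m e u -> G k e u.
  move=> Gu; have [ed|de] := ltnP e d.
    by apply: KP => //; apply: Gle Gu => //; exact: leq_maxl.
  have Gd : G d d u by apply: Gle Gu => //; exact: leq_maxr.
  have := dP (maxn k e) u (leq_trans de (leq_maxr _ _)) Gd.
  by apply: Gle; [exact: leq_maxl | exact: leq_maxr].
exists m => k t mk Nt.
have [e] := tT t; elim: e t Nt => [|e IHe] t Nt.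
  by rewrite expr0 scale1r => ->; exact: (lN k).1.
rewrite exprS -scalerA => xt.
have [|s [Ns /= sE]] := mP e k (mktors xt); first by exists t.
rewrite -(subrK s t); apply: linear_setD => //; apply: IHe.
  by apply: linear_setB => //; exact: NSle Ns.
by rewrite scalerBr sE subrr.
Qed.

(** Equivalently, [T] is Artinian and [0 :_T xs] has finite length, by
    [fin_socle_intro] and [fin_socle_killed]. Peeling off one element of [xs] at
    a time lets closure under quotients follow from [serre_tors]. *)
Fixpoint fin_socle (xs : seq R) T : Prop :=
  if xs is x :: xs' then artinian T /\ fin_socle xs' (tors x T)
  else artinian T /\ noeth T.

Lemma fin_socle_serre xs : serre (fin_socle xs).
Proof.
elim: xs => [|x xs IH] /=; last exact: serre_tors.
split=> [V U sVU [aV nV]|U W [aW nW] [aQ nQ]].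
  by split; [exact: (artinian_serre R).1 aV | exact: (noeth_serre R).1 nV].
by split; [exact: (artinian_serre R).2 aQ | exact: (noeth_serre R).2 nQ].
Qed.

Lemma fin_socle_artinian xs T : fin_socle xs T -> artinian T.
Proof. by case: xs => [|x xs] []. Qed.

Lemma fin_socle_killed xs T : fin_socle xs T ->
  (forall x, x \in xs -> forall t : T, x *: t = 0) -> noeth T.
Proof.
elim: xs T => [|x xs IH] T /=; first by case.
move=> [_ fT] xsT; have xT t : x *: (t : T) = 0 by apply: xsT; exact: mem_head.
apply: (noeth_serre R).1 (IH _ fT _).
  apply: (@subquo_surj _ _ _ (\val : tors x T -> T)) => t.
  by exists (mktors (xT t)).
move=> y yxs t; apply: val_inj; rewrite /= xsT // in_cons yxs orbT //.
Qed.

Lemma fin_socle_intro xs T : artinian T ->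
  (forall N : submodClosed T,
     (forall x, x \in xs -> forall t, t \in N -> x *: t = 0) ->
     noeth (submod N)) ->
  fin_socle xs T.
Proof.
elim: xs T => [|x xs IH] T aT nT /=.
  split=> //; apply: (noeth_serre R).1 (nT (full_submod T) _) => //.
  by apply: (@subquo_surj _ _ _ (\val : submod _ -> T)) => t;
    exists (Submod (isT : t \in full_submod T)).
split=> //; apply: IH => [|N xsN].
  by apply: (artinian_serre R).1 aT; exact: subquo_submod.
pose lN := linear_set_im (\val : tors x T -> T) (linear_set_mem N).
apply: (noeth_serre R).1 (nT (mksub lN) _).
  exists (fun v u => val v = val (val u)); split.
  - by split=> // c v v' u u' /= -> ->.
  - move=> u; have uN : val (val u) \in mksub lN.
      by apply/mksubP; exists (val u) => //; exact: valP.
    by exists (Submod uN).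
  - by move=> u /esym u0; apply: val_inj; apply: val_inj.
move=> y; rewrite in_cons => /orP[/eqP->|yxs] t /mksubP[u uN ->].
  exact: tors_val.
by have /(congr1 val) := xsN y yxs u uN.
Qed.

(** The annihilated part shrinks when [y] is replaced by generators of an ideal
    containing [y], and Melkersson's criterion restores the Artinian property. *)
Lemma fin_socle_tors xs y T :
  (forall U (u : U), (forall x, x \in xs -> x *: u = 0) -> y *: u = 0) ->
  (forall t : T, exists k, y ^+ k *: t = 0) ->
  fin_socle xs (tors y T) -> fin_socle xs T.
Proof.
move=> xsy tT fT; apply: fin_socle_intro => [|N xsN].
  by apply: artinian_tors tT _; exact: fin_socle_artinian fT.
apply: fin_socle_killed (_ : fin_socle xs (submod N)) _; last first.
  by move=> x xxs t; apply: val_inj; rewrite /= xsN //; exact: valP.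
apply: (fin_socle_serre xs).1 fT.
exists (fun v u => val v = val u); split.
- by split=> // c v v' u u' /= -> ->.
- move=> u; have yu : y *: val u = 0.
    by apply: xsy => x xxs; apply: xsN => //; exact: valP.
  by exists (mktors yu).
- by move=> u /esym u0; exact: val_inj.
Qed.

End Torsion.

(** * Associated primes, regular elements and the Artin-Rees property *)

Section PrimeOfProp.
Variable R : comNzRingType.

Definition prime_set (P : R -> Prop) :=
  [/\ P 0, ~ P 1, forall a u v, P u -> P v -> P (a * u + v) &
      forall u v, P (u * v) -> P u \/ P v].

Variables (P : R -> Prop) (pP : prime_set P).

Definition prime_pred & prime_set P : {pred R} := fun x => `[< P x >].

Fact prime_pred_idealr : idealr_closed (prime_pred pP).
Proof.
have [P0 P1 PL _] := pP; split; first exact/asboolP.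
  by apply/negP => /asboolP.
move=> a u v /asboolP Pu /asboolP Pv; apply/asboolP; exact: PL.
Qed.
HB.instance Definition _ := isIdealr.Build R (prime_pred pP) prime_pred_idealr.

Fact prime_pred_prime : prime_idealr_closed (prime_pred pP).
Proof.
have [_ _ _ PM] := pP => u v /asboolP/PM[Pu|Pv]; apply/orP; [left|right];
  exact/asboolP.
Qed.
HB.instance Definition _ :=
  isPrimeIdealrClosed.Build R (prime_pred pP) prime_pred_prime.
Definition mkprime : prime_idealr R := prime_pred pP.

Lemma mkprimeP x : (x \in mkprime) <-> P x.
Proof. by split=> [/asboolP|Px]; last exact/asboolP. Qed.

End PrimeOfProp.

Section NoetherianRing.
Variable R : comNzRingType.
Hypothesis nR : noetherian_ring R.
Implicit Types (T : lmodType R) (a : ideal R).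

Lemma noeth_ring : noeth R^o.
Proof. by move=> N; apply/fg_subP/nR. Qed.

Lemma linear_set_ann T (y : T) : linear_set (fun c : R^o => (c : R) *: y = 0).
Proof.
split=> [|c u v uy vy]; first exact: scale0r.
by rewrite scalerDl vy addr0 -scalerA uy scaler0.
Qed.

Lemma linear_set_add_line T (P : T -> Prop) (w : T) : linear_set P ->
  linear_set (fun t => exists c : R, P (t - c *: w)).
Proof.
move=> [P0 PL]; split=> [|e u v [d dN] [d' d'N]].
  by exists 0; rewrite scale0r subr0.
exists (e * d + d').
rewrite [X in P X](_ : _ = e *: (u - d *: w) + (v - d' *: w)); first exact: PL.
by rewrite scalerBr addrACA scalerDl opprD scalerA.
Qed.

(** Among the annihilators of multiples of [y] that avoid [S], a maximal one is
    prime. When [S] is the complement of a prime [p], this finds an associated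
    prime inside [p] without localizing. *)
Lemma ann_prime T (y : T) (S : R -> Prop) :
  S 1 -> (forall s t, S s -> S t -> S (s * t)) ->
  (forall s, S s -> s *: y <> 0) ->
  exists r : R, prime_set (fun c => c *: (r *: y) = 0) /\
                forall s, S s -> s *: (r *: y) <> 0.
Proof.
move=> S1 SM Sy.
have [|I [[r [IE rS]] _ Imax]] := @noeth_max _ R^o (fun I => exists r : R,
    (forall c : R, (c \in I) <-> c *: (r *: y) = 0) /\
    forall s, S s -> s *: (r *: y) <> 0)
  (mksub (linear_set_ann y)) noeth_ring.
  exists 1; split=> [c|s]; last by rewrite scale1r; exact: Sy.
  by rewrite scale1r; exact: (mksubP (linear_set_ann y)).
exists r; split=> //; split; rewrite ?scale0r ?scale1r //.
- by have := rS 1 S1; rewrite scale1r.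
- by move=> c u v ur vr; rewrite scalerDl -scalerA ur vr scaler0 addr0.
have Imul v : (forall s, S s -> s *: ((v * r) *: y) <> 0) ->
    forall c, c *: ((v * r) *: y) = 0 -> c *: (r *: y) = 0.
  move=> vS c cv; apply/IE/(Imax (mksub (linear_set_ann ((v * r) *: y)))).
  - by exists (v * r); split=> // d; exact: (mksubP (linear_set_ann _)).
  - move=> d /IE dr; apply/mksubP.
    by rewrite -scalerA scalerA mulrC -scalerA dr scaler0.
  - exact/mksubP.
move=> u v uv0.
have [vS|/existsNP[s /not_implyP[Ss /contrapT sv]]] :=
    pselect (forall s, S s -> s *: ((v * r) *: y) <> 0).
  by left; apply: (Imul v) => //; rewrite -uv0 !scalerA mulrA.
right; apply: (Imul s); last by rewrite -sv !scalerA !mulrA [v * s]mulrC.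
by move=> t St; rewrite -scalerA scalerA; apply: rS; exact: SM.
Qed.

Lemma exists_prime (I : R -> Prop) : linear_set (I : R^o -> Prop) -> ~ I 1 ->
  exists p : prime_idealr R, forall x, I x -> x \in p.
Proof.
move=> lI I1.
have [|J [J1 IJ Jmax]] := @noeth_max _ R^o
    (fun J => ~ ((1 : R^o) \in J)) (mksub lI) noeth_ring.
  by move=> /(mksubP lI).
suff pJ : prime_set (fun x => x \in J).
  by exists (mkprime pJ) => x Ix; apply/mkprimeP/IJ/(mksubP lI).
split=> [||c u v uJ vJ|u v uvJ].
- exact: rpred0.
- exact: J1.
- by apply: rpredD => //; exact: (@rpredZ _ _ J c _ uJ).
have [uJ|uJ] := pselect (u \in J); [by left | right].
have lK := linear_set_add_line (u : R^o) (linear_set_mem J).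
have [[c cJ]|K1] := pselect (exists c : R, 1 - c * u \in J).
  rewrite -[v](subrK (c * (u * v))) rpredD //; last exact: (@rpredZ _ _ J c _ uvJ).
  by rewrite -[X in X - _]mul1r mulrA -mulrBl mulrC; exact: (@rpredZ _ _ J v _ cJ).
case: uJ; apply: (Jmax (mksub lK)).
- by move=> /(mksubP lK).
- by move=> x xJ; apply/(mksubP lK); exists 0; rewrite scale0r subr0.
- by apply/(mksubP lK); exists 1; rewrite scale1r subrr rpred0.
Qed.

Lemma simple_artinian T :
  (forall t s : T, t <> 0 -> exists c : R, s = c *: t) -> artinian T.
Proof.
move=> sT; apply: artinianP => N lN NS.
have [[K [K0 KP]]|nK] := pselect (exists K, ~ (exists2 t, N K t & t <> 0) /\ True).
  by exists K => k x _ Nx; rewrite (_ : x = 0); [exact: (lN k).1 |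
    apply: contrapT => x0; apply: K0; exists x].
exists 0%N => k x _ _; have [[t Nt t0]|nt] := pselect (exists2 t, N k t & t <> 0).
  by have [c ->] := sT t x t0; exact: linear_setZ.
by case: nK; exists k.
Qed.

(** A Noetherian module of dimension zero is built from finitely many simple
    modules: the annihilator of a suitable element of a proper quotient is
    prime, hence maximal since it lies in the support. *)
Lemma noeth_dim0_artinian T : noeth T -> dim_le T 0 -> artinian T.
Proof.
move=> nT /dim_le0P dT.
have aZ : artinian (submod (zero_submod T)).
  apply: simple_artinian => t s t0; case: t0; apply: val_inj.
  exact/eqP/(valP t).
have [N [aN _ Nmax]] := noeth_max (F := fun N => artinian (submod N)) nT aZ.
have [NT|/existsNP[y yN]] := pselect (forall t, t \in N).
  apply: (artinian_serre R).1 aN; apply: (@subquo_surj _ _ _ (\val : submod N -> T)).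
  by move=> t; exists (Submod (NT t)).
have y0 : quot_pi N y <> 0 by move/quot_pi_eq0.
have [|||r [pr _]] := @ann_prime _ (quot_pi N y) (fun s => s = 1).
- by [].
- by move=> s t -> ->; rewrite mul1r.
- by move=> s ->; rewrite scale1r.
pose w := r *: y; pose q := mkprime pr.
have qP c : (c \in q) <-> c *: w \in N.
  have wE : quot_pi N (c *: w) = c *: (r *: quot_pi N y) by rewrite /w !quot_piZ.
  split=> [/(mkprimeP pr) cw|cw]; first by apply/quot_pi_eq0; rewrite wE.
  by apply/(mkprimeP pr); rewrite -wE; apply/quot_pi_eq0.
have qT : supp T q.
  by apply/suppP; exists w => t /negP tq tw; apply/tq/qP; rewrite tw rpred0.
have lq : linear_set ((fun c => c \in q) : R^o -> Prop).
  by split=> [|c u v uq vq]; rewrite ?idealr0 // rpredD // idealMr.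
have qmax c : c \notin q -> exists d : R, 1 - d * c \in q.
  move=> cq; apply: contrapT => nd.
  have lI := linear_set_add_line (c : R^o) lq.
  have [p pI] := exists_prime lI nd.
  have qp : {subset q <= p} by move=> x xq; apply: pI; exists 0; rewrite scale0r subr0.
  have cp : c \in p by apply: pI; exists 1; rewrite scale1r subrr idealr0.
  by have /negP[] := cq; exact: (dT q p qT qp c cp).
pose lL' := linear_set_add_line w (linear_set_mem N).
have aB : artinian (quotmod (mksub lq)).
  apply: simple_artinian => t s t0.
  have [|d dq] := qmax (quot_repr t).
    apply/negP => tq; apply: t0; rewrite -[t]quot_reprK.
    by apply/quot_pi_eq0/mksubP.
  exists (quot_repr s * d); rewrite -[s in LHS]quot_reprK -[t]quot_reprK -linearZ /=.
  apply/eqP; rewrite quot_piE; apply/mksubP.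
  have := idealMr (quot_repr s) dq; rewrite mulrBr mulr1.
  by rewrite [X in _ - X]mulrA.
have aL : artinian (submod (mksub lL')).
  apply: (@serre_exact _ (@artinian R) (submod N) (submod (mksub lL'))
    (quotmod (mksub lq)) (fun v u => val u = val v)
    (fun u b => exists c : R, val u - c *: w \in N /\ b = quot_pi (mksub lq) c)).
  - exact: artinian_serre.
  - by split=> [|c v v' u u' /= -> ->].
  - split=> [|c u u' b b' [d [dN ->]] [e [eN ->]]].
      by exists 0; rewrite scale0r subr0 rpred0 linear0.
    exists (c * d + e); split; last by rewrite -linearP.
    rewrite [X in X \in _](_ : _ = c *: (val u - d *: w) + (val u' - e *: w)).
      by rewrite rpredD ?rpredZ.
    by rewrite /= scalerBr addrACA scalerDl opprD -(scalerA c d w).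
  - move=> u; have /mksubP[c cN] := valP u.
    by exists (quot_pi _ (c : R^o)), c.
  - move=> u [c [cN /esym/quot_pi_eq0/mksubP/qP cw]].
    have uN : val u \in N by rewrite -[val u](subrK (c *: w)) rpredD.
    by exists (Submod uN).
  - by move=> u u0; exact: val_inj.
  - exact: aN.
  - exact: aB.
have [_ nq1 _ _] := pr; case: nq1; rewrite scale1r.
suff : w \in N by move=> /quot_pi_eq0 <-; rewrite /w quot_piZ.
apply: (Nmax _ aL).
- by move=> x xN; apply/mksubP; exists 0; rewrite scale0r subr0.
- by apply/mksubP; exists 1; rewrite scale1r subrr rpred0.
Qed.

(** * Regular elements *)

Definition span T (s : seq T) (t : T) :=
  forall P : T -> Prop, linear_set P -> (forall z, z \in s -> P z) -> P t.

Lemma linear_set_span T (s : seq T) : linear_set (span s).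
Proof.
split=> [P lP _|c x y xs ys P lP Ps]; first exact: lP.1.
by apply: lP.2; [exact: xs | exact: ys].
Qed.

Definition max_ann T (y : T) := y <> 0 /\ forall z : T, z <> 0 ->
  (forall c : R, c *: y = 0 -> c *: z = 0) -> forall c : R, c *: z = 0 -> c *: y = 0.

(** Elements with maximal annihilator have prime annihilators. *)
Lemma max_ann_mul T (y : T) (c d : R) :
  max_ann y -> c *: y <> 0 -> d *: y <> 0 -> (c * d) *: y <> 0.
Proof.
move=> [y0 ymax] cy dy; rewrite -scalerA => cdy; apply: cy.
apply: (ymax (d *: y)) => // e ey.
by rewrite scalerA mulrC -scalerA ey scaler0.
Qed.

Lemma max_ann_separate T (y : T) (s : seq T) : max_ann y ->
  (forall z, z \in s -> exists c : R, c *: z = 0 /\ c *: y <> 0) ->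
  exists c : R, (forall z, z \in s -> c *: z = 0) /\ c *: y <> 0.
Proof.
move=> my; elim: s => [|z s IH] sP.
  by exists 1; split=> //; rewrite scale1r; have [] := my.
have [|c [cs cy]] := IH; first by move=> t ts; apply: sP; rewrite in_cons ts orbT.
have [d [dz dy]] := sP z (mem_head _ _).
exists (c * d); split; last exact: max_ann_mul.
move=> t; rewrite in_cons => /orP[/eqP->|ts]; first by rewrite -scalerA dz scaler0.
by rewrite mulrC -scalerA cs // scaler0.
Qed.

(** The elements with maximal annihilator lie in the span of finitely many of
    them, so there are only finitely many maximal annihilators. They are prime
    and cover the zero divisors, and prime avoidance applies to them. *)
Lemma regular_element T a : noeth T ->
  (forall y : T, (forall x, x \in a -> x *: y = 0) -> y = 0) ->
  exists2 x : R, x \in a & forall y : T, x *: y = 0 -> y = 0.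
Proof.
move=> nT aT.
have [|N [[s [sm NE]] _ Nmax]] := @noeth_max _ T (fun N => exists s : seq T,
    (forall z, z \in s -> max_ann z) /\ forall t, (t \in N) <-> span s t)
  (mksub (linear_set_span [::])) nT.
  by exists [::]; split=> // t; exact: (mksubP (linear_set_span _)).
have sall y : max_ann y -> span s y.
  move=> my; apply/NE; apply: (Nmax (mksub (linear_set_span (y :: s)))).
  - exists (y :: s); split=> [z|t]; last exact: (mksubP (linear_set_span _)).
    by rewrite in_cons => /orP[/eqP->//|/sm].
  - move=> t /NE ts; apply/mksubP => P lP Ps; apply: ts => // z zs.
    by apply: Ps; rewrite in_cons zs orbT.
  - by apply/mksubP => P lP Ps; apply: Ps; exact: mem_head.
have [x xa xs] : exists2 x : R, x \in a & forall z, z \in s -> x *: z <> 0.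
  elim: (s) sm => [|y t IH] tm; first by exists 0; [exact: rpred0 | ].
  have [|x xa xt] := IH; first by move=> z zt; apply: tm; rewrite in_cons zt orbT.
  have my := tm y (mem_head _ _).
  have [xy|xy] := pselect (x *: y = 0); last first.
    by exists x => // z; rewrite in_cons => /orP[/eqP->//|]; exact: xt.
  have [e [ea ey]] : exists e : R, e \in a /\ e *: y <> 0.
    apply: contrapT => ne; case: my => + _; apply; apply: aT => e ea.
    by apply: contrapT => ey; apply: ne; exists e.
  have [|c [ct cy]] := @max_ann_separate _ y t my.
    move=> z zt; apply: contrapT => nc; apply: (xt z zt).
    have [_ zmax] : max_ann z by apply: tm; rewrite in_cons zt orbT.
    apply: (zmax y) => //; first by case: my.
    by move=> c cz; apply: contrapT => cy; apply: nc; exists c.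
  exists (x + c * e).
    exact: (@rpredD R^o a x (c * e) xa (@rpredZ _ _ a c _ ea)).
  move=> z; rewrite in_cons => /orP[/eqP->|zt]; rewrite scalerDl.
    by rewrite xy add0r; exact: max_ann_mul.
  by rewrite [c * e]mulrC -scalerA ct // scaler0 addr0; exact: xt.
exists x => // t xt; apply: contrapT => t0.
have [|I [[y [IE y0]] It Imax]] := @noeth_max _ R^o (fun I => exists y : T,
    (forall c : R, (c \in I) <-> c *: y = 0) /\ y <> 0)
  (mksub (linear_set_ann t)) noeth_ring.
  by exists t; split=> // c; exact: (mksubP (linear_set_ann _)).
have my : max_ann y.
  split=> // z z0 yz c cz; apply/IE/(Imax (mksub (linear_set_ann z))).
  - by exists z; split=> // d; exact: (mksubP (linear_set_ann _)).
  - by move=> d /IE/yz dz; apply/mksubP.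
  - exact/mksubP.
have xy : x *: y = 0 by apply/IE/It/mksubP.
have [|c [cs]] := @max_ann_separate _ y s my; last first.
  apply; apply: (sall y my (fun z => c *: z = 0)) => //; exact: linear_set_tors.
move=> z zs; apply: contrapT => nc; apply: (xs z zs).
have [_ zmax] := sm z zs; apply: (zmax y) => //.
by move=> c cz; apply: contrapT => cy; apply: nc; exists c.
Qed.

(** * Powers of ideals *)

Lemma smul_mem T a (N : submodClosed T) r x :
  r \in a -> x \in N -> r *: x \in smul a N.
Proof.
move=> ra xN; apply/asboolP; exists [:: (r, x)]; last by rewrite big_seq1.
by move=> p; rewrite inE => /eqP->.
Qed.

Lemma smul_ind T a (N : submodClosed T) (P : T -> Prop) : linear_set P ->
  (forall r x, r \in a -> x \in N -> P (r *: x)) ->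
  forall x, x \in smul a N -> P x.
Proof.
move=> lP Prx x /asboolP[s sP ->]; elim: s sP => [|p s IH] sP.
  by rewrite big_nil; exact: lP.1.
rewrite big_cons; apply: linear_setD => //.
  by have [] := sP p (mem_head _ _); exact: Prx.
by apply: IH => q qs; apply: sP; rewrite in_cons qs orbT.
Qed.

Lemma ideal_powX a k x : x \in a -> x ^+ k \in ideal_pow a k.
Proof.
by move=> xa; elim: k => [|k IH] //; rewrite exprS; exact: (@smul_mem R^o _ _ _ _ xa IH).
Qed.

Lemma ideal_pow_le a k l r : (k <= l)%N -> r \in ideal_pow a l -> r \in ideal_pow a k.
Proof.
by move=> /subnK <-; elim: (l - k)%N => // m IH /ideal_powS_sub.
Qed.

Lemma pow_submod_mem T a k r (x : T) :
  r \in ideal_pow a k -> r *: x \in pow_submod a T k.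
Proof. by move=> rk; exact: (smul_mem rk (isT : x \in full_submod T)). Qed.

Lemma pow_submod_ind T a k (P : T -> Prop) : linear_set P ->
  (forall r x, r \in ideal_pow a k -> P (r *: x)) ->
  forall x, x \in pow_submod a T k -> P x.
Proof. by move=> lP Prx; apply: smul_ind => // r x rk _; exact: Prx. Qed.

Lemma pow_submod_le T a k l (x : T) :
  (k <= l)%N -> x \in pow_submod a T l -> x \in pow_submod a T k.
Proof.
move=> kl; move: x; apply: pow_submod_ind; first exact: linear_set_mem.
by move=> r y rl; apply: pow_submod_mem; exact: ideal_pow_le rl.
Qed.

Lemma pow_submod_map T T' a k (f : {linear T -> T'}) x :
  x \in pow_submod a T k -> f x \in pow_submod a T' k.
Proof.
move: x; apply: pow_submod_ind.
  exact: (linear_set_preim f (linear_set_mem (pow_submod a T' k))).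
by move=> r y rk; rewrite linearZ; exact: pow_submod_mem.
Qed.

(** Generation is expressed by what it gives for any submodule [P], so that no
    coefficients have to be carried along. *)
Lemma ideal_gens a : exists xs : seq R, (forall x, x \in xs -> x \in a) /\
  forall r, r \in a -> forall T (P : T -> Prop) (t : T), linear_set P ->
    (forall x, x \in xs -> P (x *: t)) -> P (r *: t).
Proof.
have [n [g [ga gE]]] := (fg_subP _).2 (nR a).
exists (codom g); split=> [_ /codomP[i ->] //|r ra T P t lP Pt].
have [c ->] := gE r ra; rewrite scaler_suml.
apply: big_ind => [|x y|i _]; first exact: lP.1.
- exact: linear_setD.
- by rewrite -scalerA; apply: linear_setZ => //; apply: Pt; exact: codom_f.
Qed.

Lemma last_nonmember T (P : T -> Prop) (xs : seq R) p : linear_set P ->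
  (forall x, x \in xs -> forall t, exists k, P (x ^+ k *: t)) -> ~ P p ->
  exists t, ~ P t /\ forall x, x \in xs -> P (x *: t).
Proof.
move=> lP; elim: xs => [|x xs IH] xsP Pp; first by exists p.
have [|//|t [Pt xst]] := IH; first by move=> y ys; apply: xsP; rewrite in_cons ys orbT.
have xt : exists k, `[< P (x ^+ k *: t) >].
  by have [k kP] := xsP x (mem_head _ _) t; exists k; exact/asboolP.
case: (ex_minnP xt) => -[|k] /asboolP xk kmin; first by case: Pt; rewrite expr0 scale1r in xk.
exists (x ^+ k *: t); split=> [/asboolP/kmin|y]; first by rewrite ltnn.
rewrite in_cons => /orP[/eqP->|ys]; first by rewrite scalerA -exprS.
by rewrite scalerA mulrC -scalerA; apply: linear_setZ => //; exact: xst.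
Qed.

(** If every element of [a] acts nilpotently on each element of a Noetherian
    module [T / P], a power of [a] kills [T / P]: otherwise the submodules
    killed by the powers of [a] stabilize at a proper submodule, and an element
    outside which all generators of [a] map into it contradicts stability. *)
Lemma ideal_pow_nilp T a (P : T -> Prop) : noeth T -> linear_set P ->
  (forall x t, x \in a -> exists k, P (x ^+ k *: t)) ->
  exists s, forall r t, r \in ideal_pow a s -> P (r *: t).
Proof.
move=> nT lP aP; pose E s t := forall r, r \in ideal_pow a s -> P (r *: t).
have lE s : linear_set (E s).
  split=> [r _|c x y xE yE r rs]; first by rewrite scaler0; exact: lP.1.
  rewrite scalerDr scalerA mulrC -scalerA; apply: lP.2; [exact: xE | exact: yE].
have [|s sP] := noeth_chain nT lE.
  by move=> s t tE r /ideal_powS_sub; exact: tE.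
exists s => r t rs; suff : E s t by apply.
apply: contrapT => nE {r rs}.
have [xs [xsa agen]] := ideal_gens a.
have [|u [nEu xsu]] := @last_nonmember _ (E s) xs t (lE s) _ nE.
  move=> x /xsa xa w; have [k kP] := aP x w xa; exists k => r rs.
  exact: linear_setZ.
apply/nEu/(sP s.+1); apply: (@smul_ind R^o).
  split=> [|c x y xP yP]; first by rewrite scale0r; exact: lP.1.
  by rewrite scalerDl -scalerA; exact: lP.2.
move=> x r xa rs; rewrite -[x *: r]/(x * r) mulrC -scalerA.
apply: (agen x xa _ (fun w => P (r *: w))).
  by apply: (linear_set_preim (r \*: idfun)).
by move=> y ys; exact: xsu.
Qed.

(** The Artin-Rees property in its weak form. Choose [L] maximal among the
    submodules containing [D := a ^ t N] and meeting [N] inside [D]. Each [x] in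
    [a] is nilpotent modulo [L]: once the [(L : x ^ m)] are stationary, adding
    [x ^ m T] to [L] does not enlarge its trace on [N]. So a power of [a] maps
    [T] into [L]. *)
Lemma artin_rees T a (N : submodClosed T) t : noeth T ->
  exists s, forall x, x \in N -> x \in pow_submod a T s ->
    x \in smul (ideal_pow a t) N.
Proof.
move=> nT; pose D := smul (ideal_pow a t) N.
have [|L [[DL LN] _ Lmax]] := @noeth_max _ T (fun L =>
    (forall x, x \in D -> x \in L) /\ forall x, x \in L -> x \in N -> x \in D) D nT.
  by [].
have [|s sP] := @ideal_pow_nilp T a (fun x => x \in L) nT (linear_set_mem L).
  move=> x p xa.
  have [||m mP] := noeth_chain (N := fun m p => x ^+ m *: p \in L) nT.
  - by move=> m; exact: (linear_set_preim (x ^+ m \*: idfun) (linear_set_mem L)).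
  - by move=> m q; rewrite exprS -scalerA; exact: rpredZ.
  pose e := (m + t)%N; exists e.
  have eP k q : x ^+ k *: q \in L -> x ^+ e *: q \in L.
    by move=> /(mP k) xq; rewrite /e addnC exprD -scalerA rpredZ.
  have lL : linear_set (fun u : T => exists q : T, u - x ^+ e *: q \in L).
    split=> [|c u v [q uq] [q' vq]]; first by exists 0; rewrite scaler0 subr0 rpred0.
    exists (c *: q + q').
    rewrite [X in X \in _](_ : _ = c *: (u - x ^+ e *: q) + (v - x ^+ e *: q')).
      by rewrite rpredD ?rpredZ.
    by rewrite scalerBr addrACA scalerDr opprD !scalerA mulrC.
  apply: (Lmax (mksub lL)).
  - split=> [u uD|u /(mksubP lL)[q uq] uN].
      have uL := DL u uD.
      by apply/(mksubP lL); exists 0; rewrite scaler0 subr0.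
    apply: LN => //; rewrite -[u](subrK (x ^+ e *: q)) rpredD //.
    apply: (eP (e + e)%N); rewrite exprD -scalerA.
    rewrite -[_ *: (_ *: q)](subKr (x ^+ e *: u)) -scalerBr.
    apply: memB; last exact: rpredZ.
    apply/DL/smul_mem => //; apply: ideal_pow_le (ideal_powX e xa).
    exact: leq_addl.
  - by move=> u uL; apply/(mksubP lL); exists 0; rewrite scaler0 subr0.
  - by apply/(mksubP lL); exists p; rewrite subrr rpred0.
exists s => x xN xs; apply: LN => //; move: x xs {xN}.
by apply: pow_submod_ind; [exact: linear_set_mem | move=> r y; exact: sP].
Qed.

End NoetherianRing.

(** * Free resolutions and comparison of complexes *)

Section HomApi.
Variable R : comNzRingType.

Section HomFun.
Variables (M X : lmodType R) (z : Hom M X).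
Definition hom_fun : M -> X := val z.
Fact hom_fun_linear : linear hom_fun.
Proof. exact/asboolP/(valP z). Qed.
HB.instance Definition _ := GRing.isLinear.Build R M X _ hom_fun hom_fun_linear.
End HomFun.

Section MkHom.
Variables (M X : lmodType R) (f : {linear M -> X}).
Fact mkHom_linear : (f : M -> X) \in @linear_pred R M X.
Proof. by apply/asboolP => c x y; rewrite linearP. Qed.
Definition mkHom : Hom M X := Submod mkHom_linear.
Lemma mkHomE x : hom_fun mkHom x = f x. Proof. by []. Qed.
End MkHom.

Lemma hom_ext (M X : lmodType R) (z w : Hom M X) :
  (forall x, hom_fun z x = hom_fun w x) -> z = w.
Proof. by move=> zw; apply: val_inj; apply/funext. Qed.

Lemma hom_eq (M X : lmodType R) (z w : Hom M X) x :
  z = w -> hom_fun z x = hom_fun w x.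
Proof. by move=> ->. Qed.

Lemma hom_funP (M X : lmodType R) c (z w : Hom M X) x :
  hom_fun (c *: z + w) x = c *: hom_fun z x + hom_fun w x.
Proof. by []. Qed.

End HomApi.

Section Free.
Variables (R : comNzRingType) (S : choiceType).

Lemma free_lift_id (x : free R S) : free_lift (@basis R S) x = x.
Proof.
apply: val_inj; apply: functional_extensionality_dep => t.
rewrite (@free_liftE _ _ _ _ _ x (coef_finite x)) //.
rewrite fsbig_finite /=; last exact: coef_finite.
have coefL : linear (fun y : free R S => coef y t : R^o) by [].
pose cL := GRing.isLinear.Build R (free R S) R^o _ _ coefL.
pose cf : {linear free R S -> R^o} := HB.pack (fun y : free R S => coef y t : R^o) cL.
rewrite -[LHS]/(cf _) linear_sum /=.
have [xt|xt] := eqVneq (coef x t) 0.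
  rewrite big1_seq => [|s _]; first by rewrite -[LHS]xt.
  rewrite -[LHS]/(coef x s * (t == s)%:R).
  by case: eqVneq => [<-|]; rewrite ?xt ?mul0r ?mulr0.
have tin : t \in fset_set [set s | coef x s != 0]%classic.
  by rewrite in_fset_set; [exact/mem_set | exact: coef_finite].
rewrite (big_fsetD1 t) //= big1_seq => [|s /andP[_]].
  by rewrite addr0 -[LHS]/(coef x t * (t == t)%:R) eqxx mulr1.
rewrite in_fsetD1 => /andP[st _].
by rewrite -[LHS]/(coef x s * (t == s)%:R) eq_sym (negPf st) mulr0.
Qed.

Lemma free_ind (P : free R S -> Prop) :
  linear_set P -> (forall s, P (basis R s)) -> forall x, P x.
Proof.
move=> lP Ps x; rewrite -(free_lift_id x).
rewrite (@free_liftE _ _ _ _ _ x (coef_finite x)) //.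
rewrite fsbig_finite; last exact: coef_finite.
apply: big_ind => [|y w|s _]; first exact: lP.1.
- exact: linear_setD.
- exact: linear_setZ.
Qed.

(** Freeness in the form used for lifting: a linear relation defined on a basis
    contains the graph of a linear map. *)
Lemma free_choose (B : lmodType R) (F : free R S -> B -> Prop) :
  linear_rel F -> (forall s, exists b, F (basis R s) b) ->
  exists g : {linear free R S -> B}, forall x, F x (g x).
Proof.
move=> lF Fs; have [g gP] := choice Fs.
exists (free_lift g); apply: free_ind => [|s]; last by rewrite /= free_lift_basis.
split=> [|c x y Fx Fy]; first by rewrite linear0; exact: lF.1.
by rewrite linearP; exact: lF.2.
Qed.

End Free.

Lemma linear_rel_diff (R : comNzRingType) (V U B : lmodType R)
    (f : {linear V -> B}) (g : {linear U -> B}) (W : B -> Prop) :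
  linear_set W -> linear_rel (fun x y => W (f x - g y)).
Proof.
move=> [W0 WL]; split=> [|c x x' y y' xy x'y'].
  by rewrite (linear0 f) (linear0 g) subr0.
by rewrite (linearP f) (linearP g) opprD addrACA -scalerBr; exact: WL.
Qed.

Lemma dependent_choice (T : nat -> Type) (I : forall n, T n -> Prop)
    (Q : forall n, T n -> T n.+1 -> Prop) (t0 : T 0%N) :
  I 0%N t0 -> (forall n t, I n t -> exists t', Q n t t' /\ I n.+1 t') ->
  exists f : forall n, T n, f 0%N = t0 /\ forall n, Q n (f n) (f n.+1).
Proof.
move=> I0 step.
pose st n (t : {t | I n t}) : {t' | I n.+1 t'} :=
  let h := cid (step n (sval t) (svalP t)) in exist _ (sval h) (svalP h).2.
pose F := nat_rect (fun n => {t | I n t}) (exist _ t0 I0) st.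
exists (fun n => sval (F n)); split=> // n.
exact: (svalP (cid (step n (sval (F n)) (svalP (F n))))).1.
Qed.

Section Comparison.
Variable R : comNzRingType.

Record resolution (N : lmodType R) := Resolution {
  rgen : nat -> choiceType;
  rd : forall n, {linear free R (rgen n.+1) -> free R (rgen n)};
  reps : {linear free R (rgen 0%N) -> N};
  reps_surj : forall x, exists y, reps y = x;
  rexact0 : forall x, reps x = 0 <-> exists y, x = rd 0%N y;
  rexact : forall n x, rd n x = 0 <-> exists y, x = rd n.+1 y
}.

Definition rmod N (A : resolution N) n : lmodType R := free R (rgen A n).

Lemma rd_rd N (A : resolution N) n x : rd A n (rd A n.+1 x) = 0.
Proof. by apply/rexact; exists x. Qed.

Lemma reps_rd N (A : resolution N) x : reps A (rd A 0 x) = 0.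
Proof. by apply/rexact0; exists x. Qed.

Definition std_res (N : lmodType R) : resolution N :=
  @Resolution N (fun n => syzygy N n) (fun n => @res_d R N n) (aug N)
    (@aug_surj R N) (@res_exact0 R N) (@res_exact R N).

(** Being a coboundary of [Hom A Y]. The argument is a bare function, so that
    only its values matter. *)
Fixpoint cob N (A : resolution N) (Y : lmodType R) i :
    (rmod A i -> Y) -> Prop :=
  match i with
  | 0 => fun z => forall x, z x = 0
  | i'.+1 => fun z => exists w : {linear rmod A i' -> Y},
               forall x, z x = w (rd A i' x)
  end.

(** Comparison of a free resolution [A] with a sequence [B] that is exact only
    up to submodules [W n] of its terms. With [W n = 0] these are the usual
    comparison theorems; for [W n] the multiples by a power of an ideal they
    compare [A] with [B] modulo that power. *)
Section ModuloW.
Variables (N : lmodType R) (A : resolution N) (B : nat -> lmodType R).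
Variable dB : forall n, {linear B n.+1 -> B n}.
Variable W : forall n, B n -> Prop.
Hypothesis lW : forall n, linear_set (@W n).
Hypothesis exW : forall n p, W (dB n p) -> exists q, W (p - dB n.+1 q).

Lemma lift_mod (v0 : {linear rmod A 0 -> B 0%N}) :
  (forall x, exists q, W (v0 (rd A 0 x) - dB 0%N q)) ->
  exists v : forall n, {linear rmod A n -> B n}, v 0%N = v0 /\
    forall n x, W (v n (rd A n x) - dB n (v n.+1 x)).
Proof.
move=> v0P.
apply: (@dependent_choice (fun n => {linear rmod A n -> B n})
  (fun n v => forall x, exists q, W (v (rd A n x) - dB n q))
  (fun n v v' => forall x, W (v (rd A n x) - dB n (v' x)))) => // n v vP.
have [||v' v'P] := @free_choose _ (rgen A n.+1) (B n.+1)
    (fun x q => W (v (rd A n x) - dB n q)).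
- exact: (linear_rel_diff (v \o rd A n) (dB n)).
- by move=> s; exact: vP.
exists v'; split=> // x; apply: exW.
rewrite -[dB n _](subKr (v (rd A n (rd A n.+1 x)))).
by apply: linear_setB => //; rewrite rd_rd linear0; exact: (lW n).1.
Qed.

Lemma homotopy_mod (f : forall n, {linear rmod A n -> B n}) :
  (forall n x, W (f n (rd A n x) - dB n (f n.+1 x))) ->
  (forall x, exists q, W (f 0%N x - dB 0%N q)) ->
  exists h : forall n, {linear rmod A n -> B n.+1},
    (forall x, W (f 0%N x - dB 0%N (h 0%N x))) /\
    forall n x, W (f n.+1 x - h n (rd A n x) - dB n.+1 (h n.+1 x)).
Proof.
move=> fP f0P.
have [||h0 h0P] := @free_choose _ (rgen A 0) (B 1%N)
    (fun x q => W (f 0%N x - dB 0%N q)).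
- exact: (linear_rel_diff (f 0%N) (dB 0%N)).
- by move=> s; exact: f0P.
have [||h [hE hP]] := @dependent_choice (fun n => {linear rmod A n -> B n.+1})
  (fun n h => forall x, exists q, W (f n.+1 x - h (rd A n x) - dB n.+1 q))
  (fun n h h' => forall x, W (f n.+1 x - h (rd A n x) - dB n.+1 (h' x))) h0.
- move=> x; apply: exW; rewrite linearB.
  rewrite -[dB 0%N (f _ _)](subKr (f 0%N (rd A 0 x))) addrAC.
  by apply: linear_setB.
- move=> n h hP.
  have [||h' h'P] := @free_choose _ (rgen A n.+1) (B n.+2)
      (fun x q => W (f n.+1 x - h (rd A n x) - dB n.+1 q)).
  + exact: (linear_rel_diff (f n.+1 \- (h \o rd A n)) (dB n.+1)).
  + by move=> s; exact: hP.
  exists h'; split=> // x; apply: exW; rewrite linearB.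
  rewrite -[dB _ (f _ _)](subKr (f n.+1 (rd A n.+1 x))) addrAC.
  apply: linear_setB => //.
  by have := h'P (rd A n.+1 x); rewrite rd_rd linear0 subr0.
- by exists h; rewrite hE.
Qed.

(** The homotopy of [homotopy_mod] writes [z \o f i] as a coboundary, since [z]
    does not see the error terms in [W]. *)
Lemma homotopy_cob (f : forall n, {linear rmod A n -> B n}) (Y : lmodType R) i
    (z : {linear B i -> Y}) :
  (forall n x, W (f n (rd A n x) - dB n (f n.+1 x))) ->
  (forall x, exists q, W (f 0%N x - dB 0%N q)) ->
  (forall x, z (dB i x) = 0) -> (forall x, W x -> z x = 0) ->
  cob (fun x => z (f i x)).
Proof.
move=> fP f0P zd zW; have [h [h0P hP]] := homotopy_mod fP f0P.
case: i z zd zW => [|i] z zd zW /=.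
  move=> x; have := zW _ (h0P x); rewrite linearB zd subr0; exact.
exists (z \o h i) => x /=; have := zW _ (hP i x).
by rewrite linearB zd subr0 linearB => /eqP; rewrite subr_eq0 => /eqP.
Qed.

End ModuloW.

Section Exact.
Variables (N N' : lmodType R) (A : resolution N) (A' : resolution N').

Fact linear_set0 (B : lmodType R) : linear_set (fun x : B => x = 0).
Proof. by split=> // c x y -> ->; rewrite scaler0 addr0. Qed.

Fact rd_exact0 n (p : rmod A' n.+1) :
  rd A' n p = 0 -> exists q, p - rd A' n.+1 q = 0.
Proof. by move=> /rexact[q ->]; exists q; rewrite subrr. Qed.

Definition chain_map (f : forall n, {linear rmod A n -> rmod A' n}) :=
  forall n x, f n (rd A n x) = rd A' n (f n.+1 x).

Lemma chain_lift (g : {linear N -> N'}) :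
  exists f : forall n, {linear rmod A n -> rmod A' n},
    chain_map f /\ forall x, reps A' (f 0%N x) = g (reps A x).
Proof.
have [||f0 f0P] := @free_choose _ (rgen A 0) (rmod A' 0)
    (fun x y => reps A' y = g (reps A x)).
- by split=> [|c x x' y y' xy x'y']; rewrite ?linear0 // !linearP xy x'y'.
- by move=> s; exact: reps_surj.
have [|f [f0E fP]] := @lift_mod N A (rmod A') (rd A') (fun _ x => x = 0)
    (fun _ => linear_set0 _) rd_exact0 f0.
  move=> x; have /rexact0[q ->] : reps A' (f0 (rd A 0 x)) = 0.
    by rewrite f0P reps_rd linear0.
  by exists q; rewrite subrr.
exists f; split=> [n x|x]; last by rewrite f0E.
by apply/eqP; rewrite -subr_eq0; apply/eqP/fP.
Qed.

Lemma chain_null_cob (f : forall n, {linear rmod A n -> rmod A' n})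
    (Y : lmodType R) i (z : {linear rmod A' i -> Y}) :
  chain_map f -> (forall x, reps A' (f 0%N x) = 0) ->
  (forall x, z (rd A' i x) = 0) -> cob (fun x => z (f i x)).
Proof.
move=> fP f0 zd.
apply: (@homotopy_cob N A (rmod A') (rd A') (fun _ x => x = 0)) => //.
- by move=> n; exact: linear_set0.
- exact: rd_exact0.
- by move=> n x; rewrite fP subrr.
- by move=> x; have /rexact0[q ->] := f0 x; exists q; rewrite subrr.
- by move=> x ->; rewrite linear0.
Qed.

Lemma chain_unique_cob (f f' : forall n, {linear rmod A n -> rmod A' n})
    (Y : lmodType R) i (z : {linear rmod A' i -> Y}) :
  chain_map f -> chain_map f' ->
  (forall x, reps A' (f 0%N x) = reps A' (f' 0%N x)) ->
  (forall x, z (rd A' i x) = 0) -> cob (fun x => z (f i x) - z (f' i x)).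
Proof.
move=> fP f'P ff' zd.
have := @chain_null_cob (fun n => f n \- f' n) Y i z _ _ zd.
rewrite (_ : (fun x => z ((f i \- f' i) x)) = (fun x => z (f i x) - z (f' i x))).
  apply=> [n x|x] /=; first by rewrite fP f'P -linearB.
  by rewrite linearB /= ff' subrr.
by apply/funext => x; rewrite /= linearB.
Qed.

Lemma cob_pull (f : forall n, {linear rmod A n -> rmod A' n}) (Y : lmodType R) i
    (z : rmod A' i -> Y) :
  chain_map f -> cob z -> cob (fun x => z (f i x)).
Proof.
move=> fP; case: i z => [|i] z /= zc; first by move=> x.
by have [w wz] := zc; exists (w \o f i) => x /=; rewrite wz fP.
Qed.

End Exact.

Section CobOps.
Variables (N : lmodType R) (A : resolution N) (Y : lmodType R) (i : nat).

Lemma cobD (z w : rmod A i -> Y) :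
  cob z -> cob w -> cob (fun x => z x + w x).
Proof.
case: i z w => [|j] z w /= zc wc; first by move=> x; rewrite zc wc addr0.
have [z' zE] := zc; have [w' wE] := wc.
by exists (z' \+ w') => x /=; rewrite zE wE.
Qed.

Lemma cobN (z : rmod A i -> Y) : cob z -> cob (fun x => - z x).
Proof.
case: i z => [|j] z /= zc; first by move=> x; rewrite zc oppr0.
have [z' zE] := zc.
by exists ((-1) \*: z') => x /=; rewrite zE scaleN1r.
Qed.

Lemma cob_map (Y' : lmodType R) (g : {linear Y -> Y'}) (z : rmod A i -> Y) :
  cob z -> cob (fun x => g (z x)).
Proof.
case: i z => [|j] z /= zc; first by move=> x; rewrite zc linear0.
by have [z' zE] := zc; exists (g \o z') => x /=; rewrite zE.
Qed.

End CobOps.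

(** Over a Noetherian ring the syzygies of a finitely generated module stay
    finitely generated. *)
Section FgResolution.
Hypothesis nR : noetherian_ring R.

Definition fg_mod := {N : lmodType R | fin_gen N}.

Lemma fg_cover (N : fg_mod) : exists (m : nat) (g : 'I_m -> sval N),
  forall x, exists y : free R 'I_m, free_lift g y = x.
Proof.
case: N => N [m [g gE]]; exists m, g => x; have [c ->] := gE x.
exists (\sum_i c i *: basis R i); rewrite linear_sum; apply: eq_bigr => i _.
by rewrite linearZ /= free_lift_basis.
Qed.

Definition fg_rank N : nat := sval (cid (fg_cover N)).
Definition fg_gens N : 'I_(fg_rank N) -> sval N :=
  sval (cid (svalP (cid (fg_cover N)))).
Lemma fg_gensP N x : exists y : free R 'I_(fg_rank N), free_lift (fg_gens (N:=N)) y = x.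
Proof. exact: (svalP (cid (svalP (cid (fg_cover N))))) x. Qed.

Definition fg_eps (N : fg_mod) : {linear free R 'I_(fg_rank N) -> sval N} :=
  free_lift (fg_gens (N:=N)).

Lemma free_fin_gen m : fin_gen (free R 'I_m).
Proof.
exists m, (fun i => basis R i) => x.
pose P (y : free R 'I_m) := exists c : 'I_m -> R, y = \sum_i c i *: basis R i.
apply: (@free_ind _ _ P) => [|s].
  split=> [|c y w [d ->] [e ->]].
    by exists (fun=> 0); rewrite big1 // => i _; rewrite scale0r.
  exists (fun i => c * d i + e i); rewrite scaler_sumr -big_split.
  by apply: eq_bigr => i _; rewrite scalerDl scalerA.
exists (fun i => (i == s)%:R); rewrite (bigD1 s) //= eqxx scale1r big1 ?addr0 //.
by move=> i /negPf->; rewrite scale0r.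
Qed.

Definition fg_syz (N : fg_mod) : fg_mod :=
  exist _ (submod (kernel (fg_eps N)) : lmodType R)
    ((fg_subP _).1 (fin_gen_noeth nR (free_fin_gen _) (kernel (fg_eps N)))).

Definition fg_syzn (N : fg_mod) n : fg_mod := iter n fg_syz N.

Definition fg_d (N : fg_mod) n :
    {linear free R 'I_(fg_rank (fg_syzn N n.+1)) -> free R 'I_(fg_rank (fg_syzn N n))} :=
  (\val : submod (kernel (fg_eps (fg_syzn N n))) -> _) \o fg_eps (fg_syzn N n.+1).

Lemma fg_eps_d (N : fg_mod) n x :
  fg_eps (fg_syzn N n) x = 0 <-> exists y, x = fg_d N n y.
Proof.
split=> [x0|[y ->]]; last exact/eqP/(valP (fg_eps (fg_syzn N n.+1) y)).
have kx : x \in kernel (fg_eps (fg_syzn N n)) by exact/eqP.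
have [y yx] := @fg_gensP (fg_syzn N n.+1) (Submod kx).
by exists y; rewrite /fg_d /= /fg_eps yx.
Qed.

Lemma fg_d_exact (N : fg_mod) n x :
  fg_d N n x = 0 <-> exists y, x = fg_d N n.+1 y.
Proof.
rewrite -fg_eps_d; split=> [x0|]; first exact: val_inj.
by rewrite /fg_d /= => ->.
Qed.

Definition fg_res (N : fg_mod) : resolution (sval N) :=
  @Resolution (sval N) (fun n => 'I_(fg_rank (fg_syzn N n)) : choiceType) (fg_d N)
    (fg_eps N) (@fg_gensP N) (@fg_eps_d N 0) (@fg_d_exact N).

Lemma fin_gen_res (N : lmodType R) : fin_gen N ->
  exists A : resolution N, forall n, fin_gen (rmod A n).
Proof.
by move=> fN; exists (fg_res (exist _ N fN)) => n; exact: free_fin_gen.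
Qed.

End FgResolution.

End Comparison.

(** * Cohomology classes and their representatives *)

Section ExtRep.
Variables (R : comNzRingType) (N X : lmodType R) (i : nat).

Definition ext_rep (z : cochain N X i) (e : Ext i N X) :=
  exists zc : z \in cocycles N X i, e = quot_pi _ (Submod zc).

Lemma cocycleP (z : cochain N X i) :
  z \in cocycles N X i <-> forall x, hom_fun z (res_d x) = 0.
Proof.
split=> [/eqP zd x|zd]; last by apply/eqP/hom_ext => x; exact: zd.
exact: hom_eq x zd.
Qed.

Lemma ext_rep_ex e : exists z, ext_rep z e.
Proof.
case: (quot_repr e) (quot_reprK e) => z zc <-; exists z.
by exists zc.
Qed.

Lemma ext_rep_linear : linear_rel ext_rep.
Proof.
split=> [|c z z' _ _ [zc ->] [z'c ->]].
  have z0 : 0 \in cocycles N X i by apply: rpred0.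
  by exists z0; rewrite -[LHS](linear0 (quot_pi _)); congr quot_pi; exact: val_inj.
have zz' : c *: z + z' \in cocycles N X i by rewrite rpredD ?rpredZ.
by exists zz'; rewrite -linearP; congr quot_pi; exact: val_inj.
Qed.

Lemma ext_rep_cocycle z e : ext_rep z e -> z \in cocycles N X i.
Proof. by case. Qed.

Lemma ext_repI z : z \in cocycles N X i -> exists e, ext_rep z e.
Proof. by move=> zc; exists (quot_pi _ (Submod zc)), zc. Qed.

Lemma ext_rep0 z :
  ext_rep z 0 <-> z \in cocycles N X i /\ z \in coboundaries N X i.
Proof.
split=> [[zc /esym/quot_pi_eq0 zb]|[zc zb]]; first by split.
by exists zc; apply/esym/quot_pi_eq0.
Qed.

Lemma ext_rep_inj z e e' : ext_rep z e -> ext_rep z e' -> e = e'.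
Proof.
move=> [zc ->] [zc' ->]; congr quot_pi; exact: val_inj.
Qed.

Lemma cobP (z : cochain N X i) :
  z \in coboundaries N X i <-> cob (A := std_res N) (hom_fun z).
Proof.
case: i z => [|j] z /=.
  split=> [/eqP-> //|z0]; apply/eqP/hom_ext => x; exact: z0.
split=> [/asboolP[w ->]|[w wz]]; first by exists (hom_fun w).
by apply/asboolP; exists (mkHom w); apply: hom_ext => x; exact: wz.
Qed.

End ExtRep.

Section ExtRepMap.
Variables (R : comNzRingType) (N N' X : lmodType R) (f : {linear N -> N'}).

Lemma ext_rep_map i (z : cochain N' X i) e :
  ext_rep z e -> ext_rep (cochain_map X f i z) (Ext_map X f i e).
Proof.
move=> [zc ->]; exists (cochain_map_cocycles f zc).
by apply: etrans (quot_mapE _ _) _; congr quot_pi; exact: val_inj.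
Qed.

End ExtRepMap.

Lemma finite_nat_bounded (A : set nat) : finite_set A ->
  exists n, forall j, A j -> (j < n)%N.
Proof.
move=> fA; exists (\sum_(j <- fset_set A) j.+1)%N => j Aj.
have jA : j \in fset_set A by rewrite in_fset_set //; exact/mem_set.
by rewrite (big_fsetD1 j) //=; exact: leq_addr.
Qed.

Section DirectLimit.
Variables (R : comNzRingType) (E : nat -> lmodType R).
Variable phi : forall k, {linear E k -> E k.+1}.

Definition single_fun k (e : E k) : dprod E := fun j =>
  if k =P j is ReflectT kj then eq_rect k (fun n => E n : Type) e j kj else 0.

Lemma single_funE k e : single_fun e k = e.
Proof.
by rewrite /single_fun; case: eqP => // kk; rewrite (eq_irrelevance kk erefl).
Qed.

Lemma single_fun0 k (e : E k) j : k <> j -> single_fun e j = 0.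
Proof. by rewrite /single_fun; case: eqP. Qed.

Fact single_finsupp k (e : E k) : single_fun e \in @finsupp_pred R nat E.
Proof.
apply/asboolP; apply: (@sub_finite_set _ _ [set k]%classic) => // j /=.
by case: (k =P j) => [/esym//|kj]; rewrite single_fun0 ?eqxx.
Qed.

Definition single k (e : E k) : dsum E := Submod (single_finsupp e).

Fact single_linear k : linear (@single k).
Proof.
move=> c x y; apply: val_inj; apply: functional_extensionality_dep => j /=.
rewrite -[RHS]/(c *: single_fun x j + single_fun y j).
case: (k =P j) => [kj|kj]; last by rewrite !single_fun0 // scaler0 addr0.
by case: j / kj; rewrite !single_funE.
Qed.
HB.instance Definition _ k :=
  GRing.isLinear.Build R (E k) (dsum E) _ (@single k) (@single_linear k).

Definition into k : {linear E k -> dirlim phi} :=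
  quot_pi (image_of (id_sub_shift phi)) \o @single k.

Lemma shift_single k (e : E k) : shift phi (single e) = single (phi k e).
Proof.
apply: val_inj; apply: functional_extensionality_dep => -[|j] /=.
  by rewrite single_fun0.
case: (k =P j) => [kj|kj]; last by rewrite !single_fun0 ?linear0 // => -[].
by case: j / kj; rewrite !single_funE.
Qed.

Lemma intoS k (e : E k) : into k e = into k.+1 (phi k e).
Proof.
apply/eqP; rewrite /into /= quot_piE; apply/asboolP; exists (single e).
by rewrite -shift_single.
Qed.

Fixpoint phin k d : E k -> E (d + k)%N :=
  match d with
  | 0 => fun e => e
  | d'.+1 => fun e => phi (d' + k)%N (phin d' e)
  end.

Lemma into_phin k d (e : E k) : into k e = into (d + k)%N (phin d e).
Proof. by elim: d => //= d ->; exact: intoS. Qed.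

Lemma dsum_bounded (x : dsum E) : exists n, forall j, (n <= j)%N -> val x j = 0.
Proof.
have /asboolP/finite_nat_bounded[n nP] := valP x.
exists n => j nj; have [//|/nP] := eqVneq (val x j) 0.
by rewrite ltnNge nj.
Qed.

Lemma into_surj q : exists k (e : E k), q = into k e.
Proof.
suff H n (x : dsum E) : (forall j, (n <= j)%N -> val x j = 0) ->
    exists k (e : E k), quot_pi (image_of (id_sub_shift phi)) x = into k e.
  have [n xn] := dsum_bounded (quot_repr q); have [k [e qe]] := H n _ xn.
  by exists k, e; rewrite -qe quot_reprK.
elim: n x => [|n IH] x xn.
  exists 0%N, 0; rewrite linear0.
  suff -> : x = 0 by rewrite linear0.
  by apply: val_inj; apply: functional_extensionality_dep => j; exact: xn.
have [j|k [e xe]] := IH (x - single (val x n)).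
  rewrite leq_eqVlt => /orP[/eqP<-|nj].
    by rewrite -[LHS]/(val x n - single_fun (val x n) n) single_funE subrr.
  rewrite -[LHS]/(val x j - single_fun (val x n) j) xn // single_fun0 ?subr0 //.
  by move=> nj'; rewrite nj' ltnn in nj.
have -> : quot_pi (image_of (id_sub_shift phi)) x = into k e + into n (val x n).
  by rewrite -xe /into /= -linearD subrK.
have [e' ->] : exists e' : E (k + n)%N, into k e = into (k + n)%N e'.
  by rewrite addnC; exists (phin n e); exact: into_phin.
by exists (k + n)%N, (e' + phin k (val x n)); rewrite linearD -into_phin.
Qed.

Lemma into_eq0 k (e : E k) : into k e = 0 -> exists d, phin d e = 0.
Proof.
move=> /quot_pi_eq0/asboolP[y yE].
have yj j : single_fun e j = val y j - val (shift phi y) j.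
  by have := congr1 (fun u : dsum E => val u j) yE.
have ylt j : (j < k)%N -> val y j = 0.
  elim: j => [|j IH] jk.
    have := yj 0%N; rewrite single_fun0 /= ?subr0 => [<-//|k0].
    by rewrite k0 in jk.
  have := yj j.+1; rewrite single_fun0 /=; last by move=> kj; rewrite kj ltnn in jk.
  by rewrite (IH (ltnW jk)) linear0 subr0 => <-.
have yk : val y k = e.
  have shk m : (forall j, (j < m)%N -> val y j = 0) -> val (shift phi y) m = 0.
    by case: m => [//|m] ym /=; rewrite ym ?linear0.
  by have := yj k; rewrite single_funE shk // subr0.
have yd d : val y (d + k)%N = phin d e.
  elim: d => [|d IH] //=; rewrite -IH.
  have := yj (d.+1 + k)%N; rewrite single_fun0 /=.
    by move=> /esym/eqP; rewrite subr_eq0 => /eqP.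
  by move=> kd; have := leq_addl d k; rewrite {1}kd addSn ltnn.
have [n yn] := dsum_bounded y; exists n; rewrite -yd yn //; exact: leq_addr.
Qed.

End DirectLimit.

(** * Generalized local cohomology through representatives *)

Section Representatives.
Variables (R : comNzRingType) (a : ideal R) (M : lmodType R).

Local Notation Mk k := (quotmod (pow_submod a M k)).
Local Notation H i X := (gen_loc_cohom i a M X).

(** Cochains on level [k] of the direct system. Keeping this a constant makes the
    level the visible index of the type. *)
Definition level (X : lmodType R) i k : lmodType R := cochain (Mk k) X i.
Local Notation C k X i := (level X i k).

Definition level_map X i k : {linear C k X i -> C k.+1 X i} :=
  cochain_map X (pow_proj a M k) i.
Arguments level_map {X i k}.

Definition postcomp (N X Y : lmodType R) (g : {linear X -> Y}) (z : Hom N X) :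
  Hom N Y := mkHom (g \o hom_fun z).

Definition tr X i k d (z : C k X i) : C (d + k)%N X i :=
  phin (fun k => @level_map X i k) d z.

Lemma trS X i k d (z : C k X i) : tr d.+1 z = level_map (tr d z).
Proof. by []. Qed.

Lemma trP X i k d c (z w : C k X i) :
  tr d (c *: z + w) = c *: tr d z + tr d w.
Proof. by elim: d => // d IH; rewrite !trS IH linearP. Qed.

Lemma level_map_d X i k (z : C k X i) :
  level_map (cochain_d (Mk k) X i z : C k X i.+1) =
  cochain_d (Mk k.+1) X i (level_map z).
Proof. exact: cochain_map_d. Qed.

Lemma tr_d X i k d (z : C k X i) :
  tr d (cochain_d (Mk k) X i z : C k X i.+1) =
  cochain_d (Mk (d + k)) X i (tr d z).
Proof. by elim: d => // d IH; rewrite !trS IH level_map_d. Qed.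

Lemma level_map_postcomp (X Y : lmodType R) (g : {linear X -> Y}) i k
    (z : C k X i) :
  level_map (postcomp g z : C k Y i) = postcomp g (level_map z).
Proof. exact: hom_ext. Qed.

Lemma tr_postcomp (X Y : lmodType R) (g : {linear X -> Y}) i k d (z : C k X i) :
  tr d (postcomp g z : C k Y i) = postcomp g (tr d z).
Proof. by elim: d => // d IH; rewrite !trS IH level_map_postcomp. Qed.

Definition hrep X i k (z : C k X i) (h : H i X) :=
  exists e, ext_rep z e /\
    h = into (fun k => Ext_map X (pow_proj a M k) i) k e.

Section Facts.
Variables (X : lmodType R) (i : nat).
Implicit Types h : H i X.

Lemma hrep_ex h : exists k (z : C k X i), hrep z h.
Proof.
have [k [e he]] := into_surj h; have [z ze] := ext_rep_ex e.
by exists k, z, e.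
Qed.

Lemma hrep_linear k : linear_rel (@hrep X i k).
Proof.
split=> [|c z z' _ _ [e [ze ->]] [e' [z'e' ->]]].
  by exists 0; split; [exact: (ext_rep_linear _ _ _).1 | rewrite linear0].
exists (c *: e + e'); split; last by rewrite linearP.
exact: (ext_rep_linear _ _ _).2.
Qed.

Lemma hrepS k (z : C k X i) h :
  hrep z h -> hrep (level_map z) h.
Proof.
move=> [e [ze ->]]; exists (Ext_map X (pow_proj a M k) i e).
by split; [exact: ext_rep_map | rewrite intoS].
Qed.

Lemma hrep_tr k d (z : C k X i) h : hrep z h -> hrep (tr d z) h.
Proof. by move=> zh; elim: d => // d IH; rewrite trS; exact: hrepS. Qed.

Lemma hrep_cocycle k (z : C k X i) h : hrep z h -> z \in cocycles (Mk k) X i.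
Proof. by move=> [e [/ext_rep_cocycle]]. Qed.

Lemma hrepI k (z : C k X i) : z \in cocycles (Mk k) X i -> exists h, hrep z h.
Proof.
by move=> /ext_repI[e ze]; exists (into (fun k => Ext_map X (pow_proj a M k) i) k e), e.
Qed.

Lemma hrep_inj k (z : C k X i) h h' : hrep z h -> hrep z h' -> h = h'.
Proof. by move=> [e [ze ->]] [e' [ze' ->]]; rewrite (ext_rep_inj ze ze'). Qed.

Lemma hrep0 k (z : C k X i) :
  hrep z 0 -> exists d, tr d z \in coboundaries (Mk (d + k)) X i.
Proof.
move=> [e [ze /esym/into_eq0[d ed]]]; exists d.
have : ext_rep (tr d z) (phin (fun k => Ext_map X (pow_proj a M k) i) d e).
  by elim: (d) => // d' IH; rewrite trS; exact: ext_rep_map.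
by rewrite ed => /ext_rep0[].
Qed.

Lemma hrep_cob k (z : C k X i) h :
  hrep z h -> z \in coboundaries (Mk k) X i -> h = 0.
Proof.
move=> zh zb; have zc := hrep_cocycle zh.
apply: hrep_inj zh _; exists 0; rewrite linear0; split=> //.
by apply/ext_rep0; split.
Qed.

End Facts.

(** Classes are represented on different levels; relations that persist from
    each level to the next are linear once they are linear on each level. *)
Lemma linear_rel_level (V U : lmodType R) (S : nat -> V -> U -> Prop) :
  (forall k, linear_rel (S k)) -> (forall k v u, S k v u -> S k.+1 v u) ->
  linear_rel (fun v u => exists k, S k v u).
Proof.
move=> lS SS; have Sd k d v u : S k v u -> S (d + k)%N v u.
  by move=> Sv; elim: d => // d; exact: SS.
split=> [|c v v' u u' [k Sv] [k' Sv']]; first by exists 0%N; exact: (lS 0%N).1.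
exists (k' + k)%N; apply: (lS _).2; first exact: Sd.
by rewrite addnC; exact: Sd.
Qed.

Lemma postcompP (N X Y : lmodType R) (g : {linear X -> Y}) c (z w : Hom N X) :
  postcomp g (c *: z + w) = c *: postcomp g z + postcomp g w.
Proof.
apply: hom_ext => x.
by rewrite -[LHS]/(g (c *: hom_fun z x + hom_fun w x)) linearP.
Qed.

Lemma postcomp0 (N X Y : lmodType R) (g : {linear X -> Y}) :
  postcomp g (0 : Hom N X) = 0.
Proof. by apply: hom_ext => x; rewrite mkHomE /= linear0. Qed.

Lemma postcompB (N X Y : lmodType R) (g : {linear X -> Y}) (z w : Hom N X) :
  postcomp g (z - w) = postcomp g z - postcomp g w.
Proof. by rewrite addrC -scaleN1r postcompP scaleN1r addrC. Qed.

Lemma postcomp_d (N X Y : lmodType R) (g : {linear X -> Y}) i (z : cochain N X i) :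
  cochain_d N Y i (postcomp g z) = postcomp g (cochain_d N X i z).
Proof. exact: hom_ext. Qed.

Lemma cochain_dd (N X : lmodType R) i (z : cochain N X i) :
  cochain_d N X i.+1 (cochain_d N X i z) = 0.
Proof.
apply: hom_ext => x.
rewrite -[LHS]/(hom_fun z (rd (std_res N) i (rd (std_res N) i.+1 x))) rd_rd.
exact: linear0.
Qed.

Lemma cob_cocycle (N X : lmodType R) i (z : cochain N X i) :
  z \in coboundaries N X i -> z \in cocycles N X i.
Proof.
case: i z => [|i] z /=; first by move=> /eqP->; exact: rpred0.
by move=> /asboolP[w ->]; apply/eqP; exact: cochain_dd.
Qed.

(** The homomorphism induced by [g] in cohomology. Both classes are represented
    on a common level, and no representative has to be chosen. *)
Definition hmap (X Y : lmodType R) (g : {linear X -> Y}) i (h : H i X) (h' : H i Y) :=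
  exists k, exists z : C k X i, hrep z h /\ hrep (postcomp g z : C k Y i) h'.

Lemma hmap_linear (X Y : lmodType R) (g : {linear X -> Y}) i : linear_rel (@hmap X Y g i).
Proof.
apply: linear_rel_level => [k|k v u [z [zv zu]]].
  split=> [|c v v' u u' [z [zv zu]] [z' [zv' zu']]].
    by exists 0; rewrite postcomp0; split; exact: (hrep_linear _ _ _).1.
  by exists (c *: z + z'); rewrite postcompP; split; exact: (hrep_linear _ _ _).2.
exists (level_map z); split; first exact: hrepS.
by rewrite -level_map_postcomp; exact: hrepS.
Qed.

Lemma hmap_total (X Y : lmodType R) (g : {linear X -> Y}) i (h : H i X) :
  exists h', hmap g h h'.
Proof.
have [k [z zh]] := hrep_ex h.
have [|h' zh'] := @hrepI Y i k (postcomp g z); last by exists h', k, z.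
have /eqP zd := hrep_cocycle zh.
by apply/eqP; rewrite postcomp_d zd postcomp0.
Qed.

Lemma hmap0 (X Y : lmodType R) (g : {linear X -> Y}) i (h : H i Y) : hmap g 0 h -> h = 0.
Proof.
move=> [k [z [z0 zh]]]; have [d zb] := hrep0 z0.
have := hrep_tr d zh; rewrite tr_postcomp => /hrep_cob; apply.
apply/cobP; have /cobP := zb; exact: (cob_map g).
Qed.

Section LongExactSequence.
Variables (A B D : lmodType R) (f : {linear A -> B}) (g : {linear B -> D}).
Hypothesis finj : injective f.
Hypothesis gsurj : forall c, exists b, g b = c.
Hypothesis fg_exact : forall b, g b = 0 <-> exists x, b = f x.

Lemma postcomp_gf N (z : Hom N A) : postcomp g (postcomp f z) = 0.
Proof.
by apply: hom_ext => x; rewrite mkHomE; apply/fg_exact; exists (hom_fun z x).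
Qed.

Lemma postcomp_inj N : injective (@postcomp N A B f).
Proof.
move=> z w zw; apply: hom_ext => x; apply: finj.
exact: hom_eq x zw.
Qed.

Lemma cochain_surj N i (c : cochain N D i) :
  exists b : cochain N B i, postcomp g b = c.
Proof.
have [||b bc] := @free_choose _ (syzygy N i) B (fun x y => g y = hom_fun c x).
- by split=> [|e x x' y y' xy x'y']; rewrite ?linear0 // !linearP xy x'y'.
- by move=> s; exact: gsurj.
by exists (mkHom b); apply: hom_ext => x; exact: bc.
Qed.

Lemma cochain_ker N i (b : cochain N B i) : postcomp g b = 0 ->
  exists w : cochain N A i, postcomp f w = b.
Proof.
move=> gb.
have [||w wb] := @free_choose _ (syzygy N i) A (fun x y => hom_fun b x = f y).
- by split=> [|e x x' y y' xy x'y']; rewrite ?linear0 // !linearP /= xy x'y'.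
- move=> s; apply/fg_exact; exact: hom_eq (basis R s) gb.
by exists (mkHom w); apply: hom_ext => x; rewrite mkHomE /= wb.
Qed.

(** The cochain bounding the image is lifted to [B], as the resolution is free.
    Both exactness at the middle term and the well-definedness of the connecting
    map rest on this. *)
Lemma cob_surj N i (z : cochain N B i) : (postcomp g z : cochain N D i) \in coboundaries N D i ->
  exists2 b : cochain N B i, b \in coboundaries N B i &
    exists w : cochain N A i, postcomp f w = z - b.
Proof.
case: i z => [|i] z /=.
  move=> /eqP gz; exists 0; first exact: rpred0.
    by rewrite subr0; exact: (@cochain_ker N 0%N).
move=> /asboolP[c gz]; have [b bc] := cochain_surj c.
exists (cochain_d N B i b); first by apply/asboolP; exists b.
by apply: (@cochain_ker N i.+1); rewrite postcompB gz -postcomp_d bc subrr.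
Qed.

Lemma cocycle_f N i (w : cochain N A i) :
  (postcomp f w : cochain N B i) \in cocycles N B i -> w \in cocycles N A i.
Proof.
move=> /eqP; rewrite postcomp_d => fw; apply/eqP; apply: postcomp_inj.
by rewrite fw postcomp0.
Qed.

(** The connecting homomorphism. The lift [z] is not unique; [hdelta0] says that
    the class of [w] does not depend on it. *)
Definition hdelta i (h : H i D) (h' : H i.+1 A) :=
  exists k, exists (z : C k B i) (w : C k A i.+1),
    [/\ hrep (postcomp g z : C k D i) h, hrep w h' &
        cochain_d (Mk k) B i z = postcomp f w].

Lemma hdelta_linear i : linear_rel (@hdelta i).
Proof.
apply: linear_rel_level => [k|k v u [z [w [zv wu zw]]]].
  split=> [|c v v' u u' [z [w [zv wu zw]]] [z' [w' [zv' wu' zw']]]].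
    exists 0, 0; rewrite !postcomp0 linear0; split=> //; exact: (hrep_linear _ _ _).1.
  exists (c *: z + z'), (c *: w + w').
  by rewrite !postcompP linearP zw zw'; split=> //; exact: (hrep_linear _ _ _).2.
exists (level_map z), (level_map w).
split; last by rewrite -level_map_d zw level_map_postcomp.
  by rewrite -level_map_postcomp; exact: hrepS.
exact: hrepS.
Qed.

Lemma exact_mid i (h : H i B) : hmap g h 0 -> exists h', hmap f h' h.
Proof.
move=> [k [z [zh /hrep0[d]]]]; rewrite tr_postcomp => /cob_surj[b bb [w wzb]].
have wc : w \in cocycles (Mk (d + k)) A i.
  apply: cocycle_f; rewrite wzb; apply: memB; last exact: cob_cocycle.
  exact: hrep_cocycle (hrep_tr d zh).
have [h' wh'] := hrepI wc; exists h', (d + k)%N, w; split=> //; rewrite wzb.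
have [h0 bh0] := hrepI (cob_cocycle bb).
have := linear_relB (@hrep_linear B i (d + k)) (hrep_tr d zh) bh0.
by rewrite (hrep_cob bh0 bb) subr0.
Qed.

Lemma hdelta_total i (h : H i D) : exists h', hdelta h h'.
Proof.
have [k [c ch]] := hrep_ex h; have [z zc] := cochain_surj c.
have [|w wz] := @cochain_ker _ _ (cochain_d (Mk k) B i z).
  by rewrite -postcomp_d zc; exact/eqP/(hrep_cocycle ch).
have [|h' wh'] := @hrepI A i.+1 k w.
  by apply: cocycle_f; rewrite wz; apply/eqP; exact: cochain_dd.
by exists h', k, z, w; rewrite zc.
Qed.

Lemma exact_quot i (h : H i D) : hdelta h 0 -> exists h', hmap g h' h.
Proof.
move=> [k [z [w [zh /hrep0[d /asboolP[v wv]] zw]]]].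
have [|h' zh'] := @hrepI B i (d + k) (tr d z - postcomp f v).
  apply/eqP; rewrite linearB /= -tr_d zw tr_postcomp wv postcomp_d subrr //.
exists h', (d + k)%N, (tr d z - postcomp f v); split=> //.
by rewrite postcompB postcomp_gf subr0 -tr_postcomp; exact: hrep_tr.
Qed.

Lemma exact_sub i (h : H i.+1 A) : hmap f h 0 -> exists h', hdelta h' h.
Proof.
move=> [k [w [wh /hrep0[d]]]]; rewrite tr_postcomp => /asboolP[z wz].
have [|h' zh'] := @hrepI D i (d + k) (postcomp g z).
  by apply/eqP; rewrite postcomp_d -wz postcomp_gf.
exists h', (d + k)%N, z, (tr d w); split=> //; exact: hrep_tr.
Qed.

Lemma exact_sub0 (h : H 0 A) : hmap f h 0 -> h = 0.
Proof.
move=> [k [w [wh /hrep0[d]]]]; rewrite tr_postcomp => /eqP fw.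
apply: (hrep_cob (hrep_tr d wh)); apply/eqP; apply: postcomp_inj.
by rewrite fw postcomp0.
Qed.

Lemma hdelta0 i (h : H i.+1 A) : hdelta 0 h -> h = 0.
Proof.
move=> [k [z [w [z0 wh zw]]]]; have [d] := hrep0 z0.
rewrite tr_postcomp => /cob_surj[b bb [v vzb]].
apply: (hrep_cob (hrep_tr d wh)); apply/asboolP; exists v.
apply: postcomp_inj; rewrite -postcomp_d vzb linearB /= -tr_d zw tr_postcomp.
by have /eqP-> := cob_cocycle bb; rewrite subr0.
Qed.

End LongExactSequence.

End Representatives.

Arguments level_map {R a M X i k}.

(** * Annihilators and finiteness of Ext *)

Section ExtFiniteness.
Variable R : comNzRingType.

(** Multiplication by [r] on the resolution lifts multiplication by [r] on [N],
    which is zero, so it is null homotopic. *)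
Lemma killed_cob (N X : lmodType R) (r : R) i (z : cochain N X i) :
  (forall x : N, r *: x = 0) -> z \in cocycles N X i ->
  r *: z \in coboundaries N X i.
Proof.
move=> rN /cocycleP zd; apply/cobP.
have := @chain_null_cob R N N (std_res N) (std_res N)
  (fun n => r \*: (idfun : {linear rmod (std_res N) n -> _})) X i (hom_fun z).
rewrite (_ : (fun x => _) = hom_fun (r *: z)); last first.
  by apply/funext => x; rewrite -[LHS]/(hom_fun z (r *: x)) linearZ.
apply=> [n x|x|//]; first by rewrite /= linearZ.
by rewrite /= linearZ /= rN.
Qed.

(** A resolution by finite free modules is homotopy equivalent to the standard
    one, so that a class is determined by the values of a cocycle on finitely
    many elements. *)
Lemma Ext_subquo (N T : lmodType R) i : noetherian_ring R -> fin_gen N ->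
  exists m, subquo ({ffun 'I_m -> T} : lmodType R) (Ext i N T).
Proof.
move=> nR fN; have [A fA] := fin_gen_res nR fN.
have [u [uP u0]] := chain_lift (std_res N) A (idfun : {linear N -> N}).
have [v [vP v0]] := chain_lift A (std_res N) (idfun : {linear N -> N}).
have [m [g gE]] := fA i; exists m.
exists (fun (t : {ffun 'I_m -> T}) (e : Ext i N T) =>
  exists2 z : cochain N T i, ext_rep z e & forall s, t s = hom_fun z (v i (g s))).
split.
- split=> [|c t t' e e' [z ze tz] [z' z'e' t'z']].
    by exists 0; [exact: (ext_rep_linear _ _ _).1 | move=> s; rewrite ffunE].
  exists (c *: z + z'); first exact: (ext_rep_linear _ _ _).2.
  by move=> s; rewrite !ffunE tz t'z' hom_funP.
- move=> e; have [z ze] := ext_rep_ex e.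
  by exists [ffun s => hom_fun z (v i (g s))], z => // s; rewrite ffunE.
- move=> e [z ze zg]; have zc := ext_rep_cocycle ze.
  have zv x : hom_fun z (v i x) = 0.
    have [c ->] := gE x; rewrite !linear_sum big1 // => s _.
    by rewrite !linearZ /= -zg ffunE scaler0.
  apply: ext_rep_inj ze _; apply/ext_rep0; split=> //; apply/cobP.
  have := @chain_unique_cob R N N (std_res N) (std_res N)
    (fun n => idfun : {linear rmod (std_res N) n -> _}) (fun n => v n \o u n) T i (hom_fun z).
  rewrite (_ : (fun x => _) = hom_fun z); last first.
    by apply/funext => x /=; rewrite zv subr0.
  apply=> [//|n x|x|]; first by rewrite /= uP vP.
    by rewrite /= v0 /= u0.
  exact/cocycleP.
Qed.

End ExtFiniteness.

(** * Cohomology with coefficients killed by a power of the ideal *)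

Section ResolutionArtinRees.
Variables (R : comNzRingType) (nR : noetherian_ring R) (a : ideal R).

(** Artin-Rees for the image of the differential: the complex stays exact modulo
    powers of [a], up to a shift of the exponent. *)
Lemma res_artin_rees (N : lmodType R) (A : resolution N) j s :
  fin_gen (rmod A j) ->
  exists s', forall p : rmod A j.+1,
    rd A j p \in pow_submod a (rmod A j) s' ->
    exists q, p - rd A j.+1 q \in pow_submod a (rmod A j.+1) s.
Proof.
move=> /(fin_gen_noeth nR) nA.
have [s' sP] := artin_rees nR a (image_of (rd A j)) s nA.
exists s' => p dp.
have dpI : rd A j p \in image_of (rd A j) by apply/asboolP; exists p.
have [p' p's dpp'] : exists2 p', p' \in pow_submod a (rmod A j.+1) s & rd A j p = rd A j p'.
  move: (sP _ dpI dp); move: (rd A j p).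
  apply: smul_ind.
    exact: (linear_set_im (rd A j) (linear_set_mem (pow_submod a (rmod A j.+1) s))).
  move=> r x rs /asboolP[q ->]; exists (r *: q); last by rewrite linearZ.
  exact: pow_submod_mem.
have /rexact[q qE] : rd A j (p - p') = 0 by rewrite linearB dpp' subrr.
by exists q; rewrite -qE subKr.
Qed.

(** The shifts [rho] of the exponents in successive degrees are absorbed by
    choosing the exponents downwards from degree [n]; above it they may be
    zero. *)
Lemma exponent_sequence (rho : nat -> nat -> nat) n e :
  (forall j, rho j 0%N = 0%N) ->
  exists l : nat -> nat, (forall j, (rho j (l j.+1) <= l j)%N) /\
    forall j, (j <= n)%N -> (e <= l j)%N.
Proof.
elim: n rho => [|n IH] rho rho0.
  by exists (fun j => if j is 0%N then e else 0%N); split=> [j|[]//]; rewrite rho0.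
have [|l [lP le]] := IH (fun j => rho j.+1); first by move=> j; exact: rho0.
exists (fun j => if j is j'.+1 then l j' else maxn e (rho 0%N (l 0%N))).
split=> [[|j]|[_|j jn]] /=; first exact: leq_maxr.
- exact: lP.
- exact: leq_maxl.
- exact: le.
Qed.

(** The failure of [v] to be a chain map lies in [W], which linear maps to [Y]
    do not see. *)
Lemma cob_pull_mod (N N' : lmodType R) (A : resolution N) (A' : resolution N')
    (W : forall n, rmod A' n -> Prop) (v : forall n, {linear rmod A n -> rmod A' n})
    (Y : lmodType R) i (c : rmod A' i -> Y) :
  (forall n x, W n (v n (rd A n x) - rd A' n (v n.+1 x))) ->
  (forall j x, (j <= i)%N -> W j x -> forall w : {linear rmod A' j -> Y}, w x = 0) ->
  cob c -> cob (fun x => c (v i x)).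
Proof.
move=> vP WY; case: i c WY => [|i] c WY /=; first by move=> c0 x.
move=> [w wc]; exists (w \o v i) => x /=; rewrite wc; apply/esym/eqP.
by rewrite -subr_eq0 -linearB (WY i _ (leqnSn i) (vP i x)).
Qed.

End ResolutionArtinRees.

Section TorsionCoefficients.
Variables (R : comNzRingType) (nR : noetherian_ring R) (a : ideal R).
Variables (M : lmodType R) (fM : fin_gen M).

Local Notation Mk k := (quotmod (pow_submod a M k)).
Local Notation H i X := (gen_loc_cohom i a M X).
Local Notation C k X i := (level a M X i k).

Definition level_res k : resolution (Mk k) := std_res (Mk k).

Lemma free_map_comp (N N' N'' : lmodType R) (f : {linear N -> N'})
    (g : {linear N' -> N''}) (h : {linear N -> N''}) x :
  (forall x, h x = g (f x)) -> free_map h x = free_map g (free_map f x).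
Proof.
move=> hE; apply: etrans (esym (free_lift_comp _ (free_map g) x)).
congr (free_lift _ x); apply/funext => y; apply: etrans (esym (free_lift_basis _ _)).
by rewrite hE.
Qed.

Lemma syzygy_map_comp (N N' N'' : lmodType R) (f : {linear N -> N'})
    (g : {linear N' -> N''}) (h : {linear N -> N''}) n x :
  (forall x, h x = g (f x)) -> syzygy_map h n x = syzygy_map g n (syzygy_map f n x).
Proof.
move=> hE; elim: n x => [|n IH] x //=; apply: val_inj => /=.
exact: free_map_comp.
Qed.

Lemma res_map_comp (N N' N'' : lmodType R) (f : {linear N -> N'})
    (g : {linear N' -> N''}) (h : {linear N -> N''}) n x :
  (forall x, h x = g (f x)) -> res_map h n x = res_map g n (res_map f n x).
Proof. by move=> hE; apply: free_map_comp => y; exact: syzygy_map_comp. Qed.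

(** The transition maps of the direct system come from chain maps over the
    projections [M / a ^ l M -> M / a ^ k M]. *)
Definition transition X i k l (t : C k X i -> C l X i) :=
  exists T : forall n, {linear rmod (level_res l) n -> rmod (level_res k) n},
  [/\ chain_map T,
      forall z x, hom_fun (t z) x = hom_fun z (T i x) &
      forall x m, reps (level_res l) x = quot_pi _ m ->
                  reps (level_res k) (T 0%N x) = quot_pi _ m].

Lemma transition_id X i k : transition (fun z : C k X i => z).
Proof. by exists (fun n => idfun). Qed.

Lemma transitionS X i k l (t : C k X i -> C l X i) :
  transition t -> transition (fun z => level_map (t z)).
Proof.
move=> [T [TP Tt T0]].
exists (fun n => T n \o (res_map (pow_proj a M l) n : {linear rmod (level_res l.+1) n -> rmod (level_res l) n})).
split=> [n x|z x|x m xm] /=.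
- by rewrite -TP; congr (T n _); exact: res_map_d.
- by rewrite -Tt.
- apply: T0; apply: etrans (aug_natural _ _) _; rewrite [aug _ x]xm.
  exact: quot_mapE.
Qed.

Lemma transition_tr X i k d : transition (@tr R a M X i k d).
Proof.
elim: d => [|d IH]; first exact: transition_id.
exact: (transitionS IH).
Qed.

Definition to_level k : {linear M -> Mk k} := quot_pi (pow_submod a M k).

Lemma level_map_res X i k (z : C k X i) x :
  hom_fun (level_map z) (res_map (to_level k.+1) i x) =
  hom_fun z (res_map (to_level k) i x).
Proof.
rewrite -[LHS]/(hom_fun z (res_map (pow_proj a M k) i (res_map (to_level k.+1) i x))).
congr (hom_fun z _); apply/esym/res_map_comp => y.
by apply/esym; exact: quot_mapE.
Qed.

Variables (Y : lmodType R) (e : nat).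
Hypothesis aY : forall r (y : Y), r \in ideal_pow a e -> r *: y = 0.

Lemma killed_pow (B : lmodType R) (w : {linear B -> Y}) l x :
  (e <= l)%N -> x \in pow_submod a B l -> w x = 0.
Proof.
move=> el; move: x; apply: pow_submod_ind; first exact: linear_set_ker.
by move=> r x rl; rewrite linearZ /= aY //; exact: ideal_pow_le rl.
Qed.

(** A class of [H i Y] is determined by the restriction of a cocycle to a
    resolution [A] of [M] by finite free modules. The maps from [A] to
    resolutions of the [M / a ^ k M] have an inverse modulo powers of [a], by
    the Artin-Rees property, and [Y] only sees cochains modulo [a ^ e]. *)
Lemma restriction_cob (A : resolution M) (b : forall n, {linear rmod A n -> rmod (std_res M) n})
    i k (z : C k Y i) :
  (forall n, fin_gen (rmod A n)) -> chain_map b ->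
  (forall x, reps (std_res M) (b 0%N x) = reps A x) ->
  z \in cocycles (Mk k) Y i ->
  (forall x, hom_fun z (res_map (to_level k) i (b i x)) = 0) ->
  exists d, tr d z \in coboundaries (Mk (d + k)) Y i.
Proof.
move=> fA bP b0 /cocycleP zd zb.
have fMk : fin_gen (Mk k).
  apply: noeth_fin_gen; apply: (noeth_serre R).1 (fin_gen_noeth nR fM).
  exact: subquo_quotmod.
have [B fB] := fin_gen_res nR fMk.
have [u [uP u0]] := chain_lift (level_res k) B (idfun : {linear Mk k -> Mk k}).
have [v [vP v0]] := chain_lift B (level_res k) (idfun : {linear Mk k -> Mk k}).
have [U [UP U0 Ub]] : exists U : forall n, {linear rmod A n -> rmod (level_res k) n},
    [/\ chain_map U, forall x, reps (level_res k) (U 0%N x) = to_level k (reps A x) &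
        forall x, U i x = res_map (to_level k) i (b i x)].
  exists (fun n => (res_map (to_level k) n : {linear rmod (std_res M) n -> rmod (level_res k) n}) \o b n).
  split=> [n x|x|//]; first by rewrite /= bP; exact: res_map_d.
  by rewrite -b0; exact: aug_natural.
(* the exponents are chosen backwards from degree [i] *)
have /choice[rho0 rho0P] (js : nat * nat) : exists s',
    (forall p : rmod A js.1.+1, rd A js.1 p \in pow_submod a _ s' ->
       exists q, p - rd A js.1.+1 q \in pow_submod a _ js.2) /\
    (forall p : rmod B js.1.+1, rd B js.1 p \in pow_submod a _ s' ->
       exists q, p - rd B js.1.+1 q \in pow_submod a _ js.2).
  have [s1 s1P] := res_artin_rees nR a js.2 (fA js.1).
  have [s2 s2P] := res_artin_rees nR a js.2 (fB js.1).
  exists (maxn s1 s2); split=> p dp; [apply: s1P | apply: s2P].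
    exact: pow_submod_le (leq_maxl _ _) dp.
  exact: pow_submod_le (leq_maxr _ _) dp.
pose rho j s := if s is 0%N then 0%N else rho0 (j, s).
have [//|l [lP le]] := @exponent_sequence rho i e.
have pow0 (T : lmodType R) (p : T) : p \in pow_submod a T 0.
  by rewrite -[p]scale1r; exact: pow_submod_mem.
have exA n p : rd A n p \in pow_submod a _ (l n) ->
    exists q, p - rd A n.+1 q \in pow_submod a _ (l n.+1).
  have := lP n; case: (l n.+1) => [|s] ln dp; first by exists 0; exact: pow0.
  by apply: (rho0P (n, s.+1)).1; exact: pow_submod_le ln dp.
have exB n p : rd B n p \in pow_submod a _ (l n) ->
    exists q, p - rd B n.+1 q \in pow_submod a _ (l n.+1).
  have := lP n; case: (l n.+1) => [|s] ln dp; first by exists 0; exact: pow0.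
  by apply: (rho0P (n, s.+1)).2; exact: pow_submod_le ln dp.
pose d := l 0%N; exists d.
have [T [TP Tz T0]] := @transition_tr Y i k d.
pose S := level_res (d + k).
have [||w0 w0P] := @free_choose _ (rgen S 0) (rmod A 0)
    (fun x p => to_level (d + k) (reps A p) = reps S x).
- by split=> [|c x x' p p' xp xp']; rewrite ?linear0 // !linearP /= xp xp'.
- move=> s; have [p pE] := reps_surj A (quot_repr (reps S (basis R s))).
  by exists p; rewrite pE; exact: quot_reprK.
have [||w [wE wP]] := @lift_mod R (Mk (d + k)) S (rmod A) (rd A)
    (fun n p => p \in pow_submod a _ (l n)) _ exA w0.
- by move=> n; exact: linear_set_mem.
- move=> x.
  have : reps A (w0 (rd S 0 x)) \in pow_submod a M (d + k).
    by apply/quot_pi_eq0; apply: etrans (w0P _) _; exact: reps_rd.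
  move=> /(pow_submod_le (leq_addr k d)) wd.
  have [p pl pE] : exists2 p, p \in pow_submod a (rmod A 0) d &
      reps A (w0 (rd S 0 x)) = reps A p.
    move: wd; move: (reps A _); apply: pow_submod_ind.
      exact: (linear_set_im (reps A) (linear_set_mem (pow_submod a (rmod A 0) d))).
    move=> r m rd; have [p <-] := reps_surj A m; exists (r *: p).
      exact: pow_submod_mem.
    by rewrite linearZ.
  have /rexact0[q qE] : reps A (w0 (rd S 0 x) - p) = 0 by rewrite linearB pE subrr.
  by exists q; rewrite -qE subKr.
have zvuP : cob (A := level_res k) (fun x => hom_fun z x - hom_fun z (v i (u i x))).
  have := @chain_unique_cob R _ _ (level_res k) (level_res k)
    (fun n => idfun : {linear rmod (level_res k) n -> _}) (fun n => v n \o u n) Y i (hom_fun z).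
  apply=> [//|n x|x|//]; first by rewrite /= uP vP.
  by rewrite /= v0 /= u0.
apply/cobP; rewrite (_ : hom_fun _ = fun x =>
  (hom_fun z (T i x) - hom_fun z (v i (u i (T i x)))) +
  (- (hom_fun z (v i (u i (U i (w i x)))) - hom_fun z (v i (u i (T i x)))) +
  (- (hom_fun z (U i (w i x)) - hom_fun z (v i (u i (U i (w i x)))))))); last first.
  apply/funext => x; rewrite Tz Ub zb sub0r opprK opprB.
  by rewrite subrK subrK.
apply: cobD; first exact: (cob_pull TP zvuP).
apply: cobD; apply: cobN; last first.
  apply: (@cob_pull_mod R _ _ S A (fun n p => p \in pow_submod a _ (l n)) w Y i
    (fun x => hom_fun z (U i x) - hom_fun z (v i (u i (U i x))))) => //.
    by move=> j x ji xl t; exact: killed_pow (le j ji) xl.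
  exact: (cob_pull UP zvuP).
have := @homotopy_cob R _ S (rmod B) (rd B) (fun n p => p \in pow_submod a _ (l n))
  (fun n => linear_set_mem _) exB
  (fun n => (u n \o (U n \o w n)) \- (u n \o T n)) Y i (hom_fun z \o v i).
rewrite (_ : (fun x => _) = (fun x => hom_fun z (v i (u i (U i (w i x)))) -
  hom_fun z (v i (u i (T i x))))); last first.
  by apply/funext => x /=; rewrite !linearB.
apply=> [n x|x|x|x xl].
- rewrite -[X in X \in _]/(u n (U n (w n (rd S n x))) - u n (T n (rd S n x)) -
    rd B n (u n.+1 (U n.+1 (w n.+1 x)) - u n.+1 (T n.+1 x))).
  rewrite TP uP (linearB (rd B n)) opprB addrA subrK -uP -UP.
  rewrite -(linearB (u n)) -(linearB (U n)).
  by do 2 apply: pow_submod_map; exact: wP.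
- have /rexact0[q qE] : reps B (u 0%N (U 0%N (w 0%N x)) - u 0%N (T 0%N x)) = 0.
    rewrite (linearB (reps B)) !u0 /= U0 (T0 x (reps A (w 0%N x))) ?subrr //.
    by rewrite wE -w0P.
  exists q; rewrite -[X in X - _]/(u 0%N (U 0%N (w 0%N x)) - u 0%N (T 0%N x)).
  by rewrite qE subrr; exact: rpred0.
- by rewrite /= vP zd.
- exact: killed_pow (le i (leqnn i)) xl.
Qed.

Lemma torsion_coef_subquo i : exists m, subquo ({ffun 'I_m -> Y} : lmodType R) (H i Y).
Proof.
have [A fA] := fin_gen_res nR fM.
have [b [bP b0]] := chain_lift A (std_res M) (idfun : {linear M -> M}).
have [m [g gE]] := fA i; exists m.
exists (fun (t : {ffun 'I_m -> Y}) (h : H i Y) => exists k, exists2 z : C k Y i, hrep z h &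
  forall s, t s = hom_fun z (res_map (to_level k) i (b i (g s)))).
split.
- apply: linear_rel_level => [k|k t h [z zh tz]].
    split=> [|c t t' h h' [z zh tz] [z' zh' tz']].
      by exists 0; [exact: (@hrep_linear R a M Y i k).1 | move=> s; rewrite ffunE].
    exists (c *: z + z'); first exact: (@hrep_linear R a M Y i k).2.
    by move=> s; rewrite !ffunE tz tz' hom_funP.
  exists (level_map z); first exact: hrepS.
  by move=> s; rewrite tz level_map_res.
- move=> h; have [k [z zh]] := hrep_ex h.
  by exists [ffun s => hom_fun z (res_map (to_level k) i (b i (g s)))], k, z => // s;
    rewrite ffunE.
- move=> h [k [z zh zg]].
  pose phi : {linear rmod A i -> Y} := (hom_fun z : {linear rmod (level_res k) i -> Y}) \o
    ((res_map (to_level k) i : {linear rmod (std_res M) i -> rmod (level_res k) i}) \o b i).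
  have phig s : phi (g s) = 0 by apply: etrans (esym (zg s)) _; rewrite ffunE.
  have [|d zb] := restriction_cob fA bP b0 (hrep_cocycle zh).
    move=> x; rewrite -[LHS]/(phi x); have [c ->] := gE x.
    rewrite linear_sum big1 // => s _; rewrite linearZ phig; exact: scaler0.
  exact: hrep_cob (hrep_tr d zh) zb.
Qed.

End TorsionCoefficients.

(** * The torsion submodule and the main induction *)

Section Main.
Variables (R : comNzRingType) (nR : noetherian_ring R) (a : ideal R).
Variables (M : lmodType R) (fM : fin_gen M).

Local Notation Mk k := (quotmod (pow_submod a M k)).
Local Notation H i X := (gen_loc_cohom i a M X).
Local Notation C k X i := (level a M X i k).
Local Notation b := (ideal_add a (ann M)).

Lemma annP (T : lmodType R) (r : R) :
  (r \in ann T) <-> forall t : T, r *: t = 0.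
Proof. by split=> [/asboolP|rT] //; exact/asboolP. Qed.

Lemma ideal_addP (I J : ideal R) (r : R) :
  (r \in ideal_add I J) <-> exists u v, [/\ u \in I, v \in J & r = u + v].
Proof. by split=> [/asboolP|rT] //; exact/asboolP. Qed.

Lemma a_sub_b (x : R) : x \in a -> x \in b.
Proof.
by move=> xa; apply/ideal_addP; exists x, 0; rewrite addr0; split=> //; exact: rpred0.
Qed.

(** Modulo [ann M], an element of [b] agrees with an element of [a]. *)
Lemma b_pow_killed (x : R) k : x \in b -> forall q : Mk k, x ^+ k *: q = 0.
Proof.
move=> /ideal_addP[u [v [ua /annP vM ->]]] q.
have uvE j (m : M) : (u + v) ^+ j *: m = u ^+ j *: m.
  elim: j m => // j IH m.
  by rewrite !exprSr -!scalerA scalerDl vM addr0 IH.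
rewrite -[q]quot_reprK -[LHS]/(quot_scale _ _) -quot_piZ uvE.
by apply/quot_pi_eq0/pow_submod_mem; exact: ideal_powX.
Qed.

Lemma cohom_torsion X i (x : R) (h : H i X) : x \in b -> exists k, x ^+ k *: h = 0.
Proof.
move=> xb; have [k [z zh]] := hrep_ex h; exists k.
apply: (@hrep_cob R a M X i k (x ^+ k *: z)).
  exact: (linear_relZ (@hrep_linear R a M X i k) _ zh).
by apply: killed_cob (hrep_cocycle zh); exact: b_pow_killed.
Qed.

Lemma prime_pow (p : prime_idealr R) (x : R) k : x ^+ k \in p -> x \in p.
Proof.
elim: k => [|k IH]; first by rewrite idealr1.
by rewrite exprS prime_idealrM => /orP[|/IH].
Qed.

Lemma cohom_supp X i (p : prime_idealr R) :
  supp (H i X) p -> forall r : R, r \in b -> r \in p.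
Proof.
move=> /suppP[h hP] r rb; have [k rh] := cohom_torsion h rb.
apply: (@prime_pow p r k); apply: contrapT => /negP rp; exact: hP rp rh.
Qed.

Lemma hrep_scale X i k (z : C k X i) (h : H i X) (c : R) :
  hrep z h -> hrep (c *: z) (c *: h).
Proof. exact: (linear_relZ (@hrep_linear R a M X i k)). Qed.

(** A finitely generated module vanishes at [p] as soon as a single element
    outside [p] kills it, and that element then kills the cohomology. *)
Lemma cohom_supp_coef G i (p : prime_idealr R) :
  fin_gen G -> supp (H i G) p -> supp G p.
Proof.
move=> [n [g gE]] /suppP[h hP]; apply: contrapT => nG.
have /choice[t tP] s : exists t : R, t \notin p /\ t *: g s = 0.
  apply: contrapT => nt; apply: nG; apply/suppP; exists (g s) => t tp tg.
  by apply: nt; exists t.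
pose T := \prod_s t s.
have Tp : T \notin p.
  apply: (big_ind (fun x : R => x \notin p)) => [|x y xp yp|s _]; first by rewrite idealr1.
    by rewrite prime_idealrM negb_or xp.
  by have [] := tP s.
have TG y : T *: (y : G) = 0.
  have [c ->] := gE y; rewrite scaler_sumr big1 // => s _.
  rewrite scalerA mulrC -scalerA /T (bigD1 s) //= mulrC -scalerA.
  by have [_ ->] := tP s; rewrite !scaler0.
apply: (hP T Tp); have [k [z zh]] := hrep_ex h.
apply: (hrep_cob (hrep_scale T zh)).
rewrite (_ : T *: z = 0); first exact: rpred0.
by apply: hom_ext => x; exact: TG.
Qed.

(** Finite generation comes from [torsion_coef_subquo] and dimension zero from
    [cohom_supp_coef]; together they give finite length. *)
Lemma cohom_fin_socle G i e (xs : seq R) :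
  noeth G -> (forall r (y : G), r \in ideal_pow a e -> r *: y = 0) ->
  dim_le G 0 -> fin_socle xs (H i G).
Proof.
move=> nG aG /dim_le0P dG; have fG := noeth_fin_gen nG.
have [m sG] := torsion_coef_subquo nR fM aG i.
have nH : noeth (H i G).
  exact: (noeth_serre R).1 sG (serre_pow m (noeth_serre R) nG).
apply: fin_socle_intro => [|N _]; last first.
  exact: (noeth_serre R).1 (subquo_submod N) nH.
apply: noeth_dim0_artinian => //; apply/dim_le0P => p q pH; apply: dG.
exact: cohom_supp_coef pH.
Qed.

Lemma linear_set_torsion (X : lmodType R) :
  linear_set (fun y : X => forall x : R, x \in b -> exists k, x ^+ k *: y = 0).
Proof.
split=> [x _|c y w yP wP x xb]; first by exists 0%N; rewrite scaler0.
have [[k yk] [l wl]] := (yP x xb, wP x xb); exists (k + l)%N.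
rewrite scalerDr scalerA mulrC -scalerA {1}addnC !exprD -!scalerA yk wl.
by rewrite !scaler0 addr0.
Qed.

(** Torsion is tested on each element of [b] separately; for Noetherian [X] this
    amounts to being killed by a power of [b], see [ideal_pow_nilp]. *)
Definition Gamma (X : lmodType R) := mksub (linear_set_torsion X).

Lemma GammaP (X : lmodType R) (y : X) :
  (y \in Gamma X) <-> forall x : R, x \in b -> exists k, x ^+ k *: y = 0.
Proof. exact: (mksubP (linear_set_torsion X)). Qed.

Lemma Gamma_quot (X : lmodType R) (q : quotmod (Gamma X)) :
  (forall x : R, x \in b -> x *: q = 0) -> q = 0.
Proof.
rewrite -[q]quot_reprK; move: (quot_repr q) => y yP; apply/quot_pi_eq0/GammaP.
move=> x xb; have : x *: y \in Gamma X.
  by apply/quot_pi_eq0; apply: etrans (quot_piZ _ _ _) _; exact: yP.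
by move=> /GammaP/(_ x xb)[k xk]; exists k.+1; rewrite exprSr -scalerA.
Qed.

(** For a prime [q] containing [ann M], let [N] be maximal among the submodules
    that contain no [c M] with [c] outside [q]. Then [M / N] is a torsion-free
    [R / q]-module of rank one, so some [c] outside [q] maps it into the line
    spanned by an element, a copy of [R / q]. *)
Lemma hom_to_domain (X : lmodType R) (q : prime_idealr R) (y : X) :
  (forall c : R, c \in ann M -> c \in q) ->
  (forall c : R, (c \in q) <-> c *: y = 0) ->
  exists (f : {linear M -> X}) (m : M), (forall t : R, t *: f m = 0 -> t \in q) /\
    forall u, exists r : R, f u = r *: y.
Proof.
move=> annq qy; have nM := fin_gen_noeth nR fM.
have [|N [NP _ Nmax]] := noeth_max (F := fun N : submodClosed M =>
    forall c : R, c \notin q -> exists u : M, c *: u \notin N) (N0 := zero_submod M) nM.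
  move=> c cq; apply: contrapT => nu; move/negP: cq; apply; apply: annq.
  apply/annP => u; apply: contrapT => cu; apply: nu; exists u.
  by apply/negP => /eqP.
have Nline (w : M) : w \notin N -> exists c : R, c \notin q /\
    forall u : M, exists r : R, c *: u - r *: w \in N.
  move=> wN; apply: contrapT => nc; move/negP: wN; apply.
  pose lL := linear_set_add_line w (linear_set_mem N).
  apply: (Nmax (mksub lL)) => [c cq|u uN|].
  - apply: contrapT => nu; apply: nc; exists c; split=> // u.
    apply: contrapT => ur; apply: nu; exists u.
    by apply/negP => /mksubP.
  - by apply/mksubP; exists 0; rewrite scale0r subr0.
  - by apply/mksubP; exists 1; rewrite scale1r subrr rpred0.
have Nq (c : R) (u : M) : c \in q -> c *: u \in N.
  move=> cq; apply: contrapT => /negP cuN.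
  have [d [dq dN]] := Nline _ cuN; have [r rN] := dN u.
  (* [e = d - r c] lies outside [q] and maps [u] into [N] *)
  pose e := d - r * c.
  have eq_ : e \notin q.
    by apply: contra dq => eq_; rewrite -(subrK (r * c) d) rpredD // idealMr.
  have eu : e *: u \in N by rewrite /e scalerBl -scalerA.
  have [|w /negP] := NP (e * d); first by rewrite prime_idealrM negb_or eq_.
  apply; have [s sN] := dN w.
  rewrite -scalerA -[d *: w](subrK (s *: (c *: u))) scalerDr.
  apply: rpredD; first exact: rpredZ.
  by rewrite scalerA mulrC -scalerA rpredZ // scalerA mulrC -scalerA rpredZ.
have [|w wN] := NP 1; first by rewrite idealr1.
rewrite scale1r in wN; have [c [cq cN]] := Nline w wN.
have rq (r : R) : r *: w \in N -> r \in q.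
  move=> rw; apply: contrapT => /negP rnq.
  have [|u /negP] := NP (r * c); first by rewrite prime_idealrM negb_or rnq.
  apply; have [s sN] := cN u.
  rewrite -scalerA -[c *: u](subrK (s *: w)) scalerDr.
  apply: rpredD; first exact: rpredZ.
  by rewrite scalerA mulrC -scalerA rpredZ.
have [rho rhoP] := choice cN.
have rhoE (r : R) u : c *: u - r *: w \in N -> r *: y = rho u *: y.
  move=> rN; apply/eqP; rewrite -subr_eq0 -scalerBl; apply/eqP/qy/rq.
  have := memB (rhoP u) rN; rewrite opprB addrC addrA subrK.
  by rewrite scalerBl addrC.
have lf : linear (fun u => rho u *: y).
  move=> d u v; rewrite -(rhoE (d * rho u + rho v)).
    by rewrite scalerDl scalerA.
  have -> : c *: (d *: u + v) - (d * rho u + rho v) *: w =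
            d *: (c *: u - rho u *: w) + (c *: v - rho v *: w).
    rewrite scalerDr scalerDl scalerBr !scalerA mulrC opprD addrACA.
    by [].
  by rewrite rpredD ?rpredZ.
pose fL := GRing.isLinear.Build R M X _ _ lf.
pose f : {linear M -> X} := HB.pack (fun u => rho u *: y) fL.
exists f, w; split=> [t|u]; last by exists (rho u).
rewrite -[f w]/(rho w *: y) -(rhoE c w) ?subrr ?rpred0 // scalerA => /qy.
by rewrite prime_idealrM (negPf cq) orbF.
Qed.

Lemma quot_factor (T X : lmodType R) (N : submodClosed T) (f : {linear T -> X}) :
  (forall u, u \in N -> f u = 0) ->
  exists F : {linear quotmod N -> X}, forall u, F (quot_pi N u) = f u.
Proof.
move=> fN; have FE u : f (quot_repr (quot_pi N u)) = f u.
  apply/eqP; rewrite -subr_eq0 -linearB; apply/eqP/fN.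
  by rewrite -quot_piE quot_reprK.
have lF : linear (fun q : quotmod N => f (quot_repr q)).
  move=> c p q; rewrite -{1}[p]quot_reprK -{1}[q]quot_reprK -linearP FE.
  by rewrite linearP.
pose FL := GRing.isLinear.Build R (quotmod N) X _ _ lF.
pose F : {linear quotmod N -> X} :=
  HB.pack (fun q : quotmod N => f (quot_repr q)) FL.
by exists F.
Qed.

(** A prime [p] of the support of [Gamma X] contains an associated prime [q] of
    [Gamma X], which contains [b]; a homomorphism from [M] to [X] with image in
    a copy of [R / q] is a class of degree zero whose annihilator lies in [p]. *)
Lemma Gamma_dim0 (X : lmodType R) :
  dim_le (H 0 X) 0 -> dim_le (submod (Gamma X)) 0.
Proof.
move=> /dim_le0P dH; apply/dim_le0P => p p' pG; apply: dH.
have [y0 y0P] := (suppP _ _).1 pG.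
have [||//|r [pr rS]] := @ann_prime R nR _ y0 (fun s => s \notin p).
- by rewrite idealr1.
- by move=> s t sp tp; rewrite prime_idealrM negb_or sp.
pose y := val (r *: y0); pose q := mkprime pr.
have qy c : (c \in q) <-> c *: y = 0.
  split=> [/(mkprimeP pr)/(congr1 val)//|cy]; apply/(mkprimeP pr).
  exact: val_inj.
have qp c : c \in q -> c \in p.
  by move=> /(mkprimeP pr) cy; apply: contrapT => /negP cp; exact: rS cp cy.
have bq x : x \in b -> x \in q.
  move=> xb; have /GammaP/(_ x xb)[k xk] := valP (r *: y0).
  by apply: (@prime_pow q x k); apply/qy.
have annq (c : R) : c \in ann M -> c \in q.
  by move=> cM; apply/bq/ideal_addP; exists 0, c; rewrite add0r; split=> //; exact: rpred0.
have [f [m [fm fy]]] := hom_to_domain annq qy.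
have fN u : u \in pow_submod a M 1 -> f u = 0.
  move: u; apply: pow_submod_ind; first exact: linear_set_ker.
  move=> s u s1; have {}sq : s \in q.
    apply/bq/a_sub_b; move: s s1; apply: smul_ind; first exact: linear_set_mem.
    by move=> c d ca _; rewrite [c *: d]mulrC; exact: (@rpredZ _ _ a d _ ca).
  rewrite linearZ; have [t ->] := fy u.
  by rewrite /= scalerA mulrC -scalerA (qy s).1 ?scaler0.
have [F FE] := quot_factor fN.
pose z : C 1%N X 0 := mkHom (F \o aug (Mk 1%N)).
have [|h zh] := @hrepI R a M X 0 1 z.
  apply/cocycleP => x; rewrite -[LHS]/(F (aug (Mk 1%N) (res_d x))).
  suff -> : aug (Mk 1%N) (res_d x) = 0 by exact: linear0.
  by apply/res_exact0; exists x.
apply/suppP; exists h => t tp th; move/negP: tp; apply; apply: qp; apply: fm.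
have := hrep_scale t zh; rewrite th => /hrep0[d /eqP tz].
have [T [_ Tz T0]] := @transition_tr R a M X 0 1 d.
have [x xm] := reps_surj (level_res a M (d + 1)) (quot_pi _ m).
have := Tz (t *: z) x; rewrite tz => /esym.
rewrite -[LHS]/(t *: F (reps (level_res a M 1) (T 0%N x))) (T0 x m xm) FE.
by [].
Qed.

Lemma hmap_scale (X : lmodType R) i (x : R) (h : H i X) :
  hmap (x \*: idfun) h (x *: h).
Proof.
have [k [z zh]] := hrep_ex h; exists k, z; split=> //.
rewrite (_ : postcomp _ z = x *: z); last exact: hom_ext.
exact: hrep_scale.
Qed.

(** Induction on [n]. Killing the torsion submodule changes the cohomology by
    modules of finite length. On the torsion-free quotient [X'] some [x] in [b]
    is regular; the sequence [0 -> X' -> X' -> X' / x X' -> 0] then presents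
    [0 :_(H i.+1 X') x] as a quotient of [H i (X' / x X')], which is known by
    induction. *)
Lemma cohom_induction (xs : seq R) n (X : lmodType R) :
  (forall r, r \in b -> forall (T : lmodType R) (P : T -> Prop) (t : T),
     linear_set P -> (forall x, x \in xs -> P (x *: t)) -> P (r *: t)) ->
  fin_gen X -> (forall i, (i < n)%N -> dim_le (H i X) 0) ->
  forall i, (i < n)%N -> fin_socle xs (H i X).
Proof.
move=> xsb; elim: n X => [//|n IH] X fX dX.
have nX := fin_gen_noeth nR fX; pose G := submod (Gamma X).
have nG : noeth G by exact: (noeth_serre R).1 (subquo_submod _) nX.
have dG : dim_le G 0 by apply: Gamma_dim0; exact: dX.
have [|e aG] := @ideal_pow_nilp R nR G a (fun y => y = 0) nG (linear_set0 G).
  move=> x y xa; have /GammaP/(_ x (a_sub_b xa))[k xk] := valP y.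
  by exists k; exact: val_inj.
have sG i : fin_socle xs (H i G) by exact: cohom_fin_socle aG dG.
pose X' := quotmod (Gamma X).
have nX' : noeth X' by exact: (noeth_serre R).1 (subquo_quotmod _) nX.
pose inc : {linear G -> X} := \val.
pose prj : {linear X -> X'} := quot_pi (Gamma X).
have incI : injective inc by exact: val_inj.
have prjS c : exists y, prj y = c by exists (quot_repr c); exact: quot_reprK.
have incprj y : prj y = 0 <-> exists x, y = inc x.
  rewrite /prj quot_pi_eq0; split=> [yG|[u ->]]; last exact: valP.
  by exists (Submod yG).
have dX' i : (i < n.+1)%N -> dim_le (H i X') 0.
  move=> /dX dXi; apply: (@serre_exact R (fun T => dim_le T 0) (H i X) (H i X')
    (H i.+1 G) (hmap prj (i := i)) (hdelta inc prj (i := i))).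
  - exact: dim0_serre.
  - exact: hmap_linear.
  - exact: hdelta_linear.
  - exact: hdelta_total.
  - exact: exact_quot.
  - exact: hmap0.
  - exact: dXi.
  - exact: artinian_dim0 (fin_socle_artinian (sG i.+1)).
have [x xb xreg] := regular_element nR nX' (@Gamma_quot X).
pose mu : {linear X' -> X'} := x \*: idfun.
have muI : injective mu.
  move=> y z; rewrite /mu /= => yz; apply/eqP; rewrite -subr_eq0; apply/eqP.
  by apply: xreg; rewrite scalerBr yz subrr.
pose D := quotmod (image_of mu); pose prD : {linear X' -> D} := quot_pi (image_of mu).
have prDS c : exists y, prD y = c by exists (quot_repr c); exact: quot_reprK.
have muprD y : prD y = 0 <-> exists z, y = mu z.
  by rewrite /prD quot_pi_eq0; split=> [/asboolP|yz] //; exact/asboolP.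
have fD : fin_gen D.
  by apply: noeth_fin_gen; exact: (noeth_serre R).1 (subquo_quotmod _) nX'.
have sD i : (i < n)%N -> fin_socle xs (H i D).
  apply: (IH D fD) => j jn.
  apply: (@serre_exact R (fun T => dim_le T 0) (H j X') (H j D)
    (H j.+1 X') (hmap prD (i := j)) (hdelta mu prD (i := j))).
  - exact: dim0_serre.
  - exact: hmap_linear.
  - exact: hdelta_linear.
  - exact: hdelta_total.
  - exact: exact_quot.
  - exact: hmap0.
  - exact/dX'/ltnW.
  - exact: dX'.
have muE i (h : tors x (H i X')) : hmap mu (val h) 0.
  by have := hmap_scale x (val h); rewrite [x *: _](tors_val h).
have sX' i : (i < n.+1)%N -> fin_socle xs (H i X').
  move=> ilt; apply: (@fin_socle_tors R xs x).
  - by move=> U u xsu; apply: (xsb x xb U (fun t => t = 0)) => //; exact: linear_set0.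
  - by move=> h; exact: cohom_torsion.
  case: i ilt => [_|i ilt].
    apply: (serre0 (fin_socle_serre xs) (sG 0%N)) => h; apply: val_inj.
    exact: (exact_sub0 muI (muE 0%N h)).
  apply: (fin_socle_serre xs).1 (sD i ilt).
  exists (fun v u => hdelta mu prD v (val u)); split.
  - exact: linear_rel_submod (hdelta_linear a M mu prD i).
  - move=> u; apply: exact_sub (muE i.+1 u); done.
  - by move=> u u0; apply: val_inj; exact: hdelta0 u0.
move=> i ilt; apply: (@serre_exact R (fin_socle xs) (H i G) (H i X) (H i X')
  (hmap inc (i := i)) (hmap prj (i := i))).
- exact: fin_socle_serre.
- exact: hmap_linear.
- exact: hmap_linear.
- exact: hmap_total.
- exact: exact_mid.
- exact: hmap0.
- exact: sG.
- exact: sX'.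
Qed.

(** [Ext i (R / b) T] is a subquotient of a power of [T] killed by [b]. *)
Lemma cohom_cofinite (xs : seq R) i (X : lmodType R) :
  (forall x, x \in xs -> x \in b) ->
  fin_socle xs (H i X) -> cofinite b (H i X).
Proof.
move=> xsb sH; split=> [p|j]; first exact: cohom_supp.
have fb : fin_gen (quotmod b).
  apply: noeth_fin_gen; apply: (noeth_serre R).1 (noeth_ring nR).
  exact: subquo_quotmod.
have [m sE] := Ext_subquo (H i X) j nR fb.
apply: noeth_fin_gen; apply: (fin_socle_killed (xs := xs)).
  exact: (fin_socle_serre xs).1 sE (serre_pow m (fin_socle_serre xs) sH).
move=> x /xsb xb e; have [z ze] := ext_rep_ex e.
apply: ext_rep_inj (linear_relZ (@ext_rep_linear R _ _ j) x ze) _.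
have zc := ext_rep_cocycle ze.
apply/ext_rep0; split; first exact: rpredZ.
apply: killed_cob zc => q; rewrite -[q]quot_reprK -[LHS]/(quot_scale _ _) -quot_piZ.
apply/quot_pi_eq0; rewrite -[x *: _]/(x * quot_repr q) mulrC.
exact: (@rpredZ _ _ b _ _ xb).
Qed.

Lemma dim0_cofinite n (X : lmodType R) : fin_gen X ->
  (forall i, (i <= n)%N -> dim_le (H i X) 0) ->
  forall i, (i <= n)%N -> artinian (H i X) /\ cofinite b (H i X).
Proof.
move=> fX dX i ilt; have [xs [xsb bxs]] := ideal_gens nR b.
have sH : fin_socle xs (H i X) by apply: (@cohom_induction xs n.+1).
by split; [exact: fin_socle_artinian sH | exact: cohom_cofinite sH].
Qed.

(** The support of [H i X] consists of primes containing [a], and those are the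
    support of [R / a]. *)
Lemma cohom_dim0 i (X : lmodType R) :
  dim_eq (quotmod a) 0 -> dim_le (H i X) 0.
Proof.
move=> [/dim_le0P dRa _]; apply/dim_le0P => p q pH; apply: dRa.
apply/suppP; exists (quot_pi a (1 : R^o)) => t tp.
rewrite -[LHS]/(quot_scale _ _) -quot_piZ => /quot_pi_eq0 ta.
move/negP: tp; apply; apply: (cohom_supp pH); apply: a_sub_b.
by move: ta; rewrite -[t *: _]/(t * 1) mulr1.
Qed.

End Main.

Theorem corollary3p2 (R : comNzRingType) (a : ideal R) (M X : lmodType R)
    (n : nat) :
  noetherian_ring R -> fin_gen M -> fin_gen X ->
  [/\ [<-> forall i, (i <= n)%N -> dim_le (gen_loc_cohom i a M X) 0;
           forall i, (i <= n)%N -> artinian (gen_loc_cohom i a M X);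
           forall i, (i <= n)%N -> artinian (gen_loc_cohom i a M X) /\
             cofinite (ideal_add a (ann M)) (gen_loc_cohom i a M X)],
      [<-> forall i, dim_le (gen_loc_cohom i a M X) 0;
           forall i, artinian (gen_loc_cohom i a M X);
           forall i, artinian (gen_loc_cohom i a M X) /\
             cofinite (ideal_add a (ann M)) (gen_loc_cohom i a M X)] &
      dim_eq (quotmod a) 0 ->
        forall i, artinian (gen_loc_cohom i a M X) /\
          cofinite (ideal_add a (ann M)) (gen_loc_cohom i a M X)].
Proof.
move=> nR fM fX; split.
- split=> [dX i ilt|]; first by have [] := dim0_cofinite nR fM fX dX ilt.
  split=> [aX|aX i ilt]; last by apply: artinian_dim0; have [] := aX i ilt.
  by apply: dim0_cofinite => // i ilt; apply: artinian_dim0; exact: aX.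
- split=> [dX i|].
    by have [] := @dim0_cofinite R nR a M fM i X fX (fun j _ => dX j) i (leqnn i).
  split=> [aX i|aX i]; last by apply: artinian_dim0; have [] := aX i.
  by apply: (@dim0_cofinite R nR a M fM i) => // j _; apply: artinian_dim0; exact: aX.
- move=> dRa i; apply: (@dim0_cofinite R nR a M fM i) => // j _.
  exact: cohom_dim0.
Qed.
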